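(* For every integer $n\ge1$ there is an isomorphism of $\mathbb{C}$-algebras $H_0(n)\otimes_{\mathbb{Z}}\mathbb{C}\simeq\mathcal{H}_0(n)$.
   Context: Generic algebra $G(n,n)$. Let $k$ be an algebraically closed field, $V$ an $n$-dimensional $k$-space, $\mathcal{F}$ the variety of $n$-step flags $f:\{0\}=V_0\subseteq\cdots\subseteq V_n=V$ (inclusions not necessarily strict). $\mathrm{GL}(V)$ acts diagonally on $\mathcal{F}\times\mathcal{F}$ with finitely many orbits. For orbits $e,e'$ let $S(e,e')=\{(f_1,f_2): \exists f\in\mathcal{F},\ (f_1,f)\in e,\ (f,f_2)\in e'\}$; if non-empty it contains a unique $\mathrm{GL}(V)$-orbit open in it (Zariski topology). $G(n,n)$ is the free $\mathbb{Z}$-module with basis the set of orbits and bilinear associative product $e\star e'$ equal to the open orbit in $S(e,e')$ if $S(e,e')\neq\emptyset$, and $0$ otherwise. Let $\underline d=(1,\dots,1)$ ($n$ entries) and let $k_{\underline d}$ be the orbit of $(h,h)$ with $h$ a complete flag ($\dim V_i=i$); it is an idempotent of $G(n,n)$. Define $H_0(n)=k_{\underline d}\,G(n,n)\,k_{\underline d}$, a $\mathbb{Z}$-algebra with identity $k_{\underline d}$; its basis is the set of orbits of pairs of complete flags. $\mathcal{H}_0(n)$ is the $0$-Hecke algebra: the $\mathbb{C}$-algebra generated by $\mathcal{T}_1,\dots,\mathcal{T}_{n-1}$ with defining relations $\mathcal{T}_i^2=-\mathcal{T}_i$; $\mathcal{T}_i\mathcal{T}_{i+1}\mathcal{T}_i=\mathcal{T}_{i+1}\mathcal{T}_i\mathcal{T}_{i+1}$;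 and $\mathcal{T}_i\mathcal{T}_j=\mathcal{T}_j\mathcal{T}_i$ for $|i-j|>1$. *)

(* Defs.v *)
From HB Require Import structures.
From mathcomp Require Import all_boot all_order all_algebra.
From mathcomp Require Import finmap mpoly xfinmap monalg.
From mathcomp Require Import boolp classical_sets reals.
From mathcomp Require Export complex.

Set Implicit Arguments.
Unset Strict Implicit.
Unset Printing Implicit Defensive.

Import GRing.Theory Quotient.
Local Open Scope ring_scope.
Local Open Scope quotient_scope.
Local Open Scope classical_set_scope.
Local Notation "g @_ k" := (monalg.mcoeff k g) : ring_scope.

Section LinearExtension.
Variables (I : choiceType) (W : zmodType).

(* The additive map Z[I] -> W with prescribed values on the basis I of the
   free Z-module {malg int[I]}. *)
Definition linext (f : I -> W) (x : {malg int[I]}) : W :=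
  \sum_(i <- msupp x) f i *~ x@_i.

Lemma linextEw f (d : {fset I}) x : fsubset (msupp x) d ->
  linext f x = \sum_(i <- d) f i *~ x@_i.
Proof.
move=> le; rewrite /linext (big_fset_incl _ le) // => i _ ix.
by rewrite mcoeff_outdom // mulr0z.
Qed.

Lemma linext_is_zmod_morphism f : zmod_morphism (linext f).
Proof.
move=> x y.
set d := fsetU (msupp x) (msupp y).
rewrite !(@linextEw f d) ?fsubsetUl ?fsubsetUr ?msuppB_le //.
by rewrite -sumrB; apply: eq_bigr => i _; rewrite mcoeffB mulrzBr.
Qed.

HB.instance Definition _ f :=
  GRing.isZmodMorphism.Build {malg int[I]} W (linext f)
    (linext_is_zmod_morphism f).

Lemma linextB f x y : linext f (x - y) = linext f x - linext f y.
Proof. exact: raddfB. Qed.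

Lemma linextD f x y : linext f (x + y) = linext f x + linext f y.
Proof. exact: raddfD. Qed.

Lemma linextU f i : linext f << i >> = f i.
Proof. by rewrite /linext msuppU oner_eq0 big_seq_fset1 mcoeffUU mulr1z. Qed.

Lemma malg_int_ind (P : {malg int[I]} -> Prop) :
  P 0 -> (forall i, P << i >>) -> (forall x y, P x -> P y -> P (x - y)) ->
  forall x, P x.
Proof.
move=> P0 PU PB.
have PN x : P x -> P (- x) by move=> Px; rewrite -[- x]sub0r; apply: PB.
have PD x y : P x -> P y -> P (x + y).
  by move=> Px Py; rewrite -[y]opprK; apply: PB => //; apply: PN.
move=> x; rewrite [x]monalgE; elim/big_ind: _ => // i _.
have PUn n : P << n%:Z *g i >>.
  elim: n => [|n IHn]; first by rewrite monalgU0.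
  by rewrite intS monalgUD; apply: PD.
case: (x@_i) => n //; rewrite NegzE monalgUN; exact: PN.
Qed.

End LinearExtension.

Section TensorProduct.
(* The tensor product over Z of an abelian group A and a commutative ring K,
   as a K-module: the free abelian group on A * K modulo biadditivity. *)
Variables (A : zmodType) (K : comNzRingType).
Local Notation F := {malg int[(A * K)%type]}.

Inductive tensor_rel : F -> Prop :=
| tensor_rel0 : tensor_rel 0
| tensor_relB x y : tensor_rel x -> tensor_rel y -> tensor_rel (x - y)
| tensor_relDl a b c :
    tensor_rel (<< (a + b, c) >> - << (a, c) >> - << (b, c) >>)
| tensor_relDr a c d :
    tensor_rel (<< (a, c + d) >> - << (a, c) >> - << (a, d) >>).

Definition tensor_relb : F -> bool := fun x => `[< tensor_rel x >].

Fact tensor_rel_zmod_closed : zmod_closed tensor_relb.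
Proof.
split=> [|x y /asboolP xr /asboolP yr]; apply/asboolP; first exact: tensor_rel0.
exact: tensor_relB.
Qed.

HB.instance Definition _ :=
  GRing.isZmodClosed.Build F tensor_relb tensor_rel_zmod_closed.

Definition tensor_relz : zmodClosed F := GRing.ZmodClosed.clone F tensor_relb _.

Definition tensor : Type := {quot tensor_relz}.

HB.instance Definition _ := GRing.Zmodule.on tensor.

Definition tens (a : A) (c : K) : tensor := \pi_({quot tensor_relz}) << (a, c) >>.

Local Notation tpi := (\pi_({quot tensor_relz}) : F -> tensor).

Lemma tpi_eq x y : reflect (tpi x = tpi y) `[< tensor_rel (x - y) >].
Proof.
apply: (iffP idP) => [h|/eqP]; first by apply/eqP; rewrite -Quotient.idealrBE.
by rewrite -Quotient.idealrBE.
Qed.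


Lemma tpi_surj (x : tensor) : exists y, x = tpi y.
Proof. by exists (repr x); rewrite reprK. Qed.

Lemma tensDl a b c : tens (a + b) c = tens a c + tens b c.
Proof.
apply/eqP; rewrite -subr_eq0 opprD addrA -!raddfB -(raddf0 tpi); apply/eqP/tpi_eq.
by rewrite subr0; apply/asboolP; apply: tensor_relDl.
Qed.

Lemma tensDr a c d : tens a (c + d) = tens a c + tens a d.
Proof.
apply/eqP; rewrite -subr_eq0 opprD addrA -!raddfB -(raddf0 tpi); apply/eqP/tpi_eq.
by rewrite subr0; apply/asboolP; apply: tensor_relDr.
Qed.

Lemma tensor_ind (P : tensor -> Prop) :
  P 0 -> (forall a c, P (tens a c)) -> (forall x y, P x -> P y -> P (x - y)) ->
  forall x, P x.
Proof.
move=> P0 PU PB x; have [y ->] := tpi_surj x.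
elim/malg_int_ind: y => [|[a c]|y z]; rewrite ?raddf0 ?raddfB //.
- exact: PU.
- exact: PB.
Qed.

Section Lift.
Variables (W : zmodType) (f : A -> K -> W).
Hypothesis fDl : forall a b c, f (a + b) c = f a c + f b c.
Hypothesis fDr : forall a c d, f a (c + d) = f a c + f a d.

Definition tensor_lift (x : tensor) : W :=
  linext (fun p => f p.1 p.2) (repr (x : {quot tensor_relz})).

Lemma tensor_lift_pi x : tensor_lift (tpi x) = linext (fun p => f p.1 p.2) x.
Proof.
apply/eqP; rewrite -subr_eq0 -raddfB.
have: tensor_rel (repr (\pi_({quot tensor_relz}) x) - x).
  by apply/asboolP/tpi_eq; rewrite reprK.
elim=> [|y z _ /eqP hy _ /eqP hz|a b c|a c d]; rewrite ?raddf0 ?raddfB //=.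
- by rewrite hy hz subrr.
- by rewrite !linextU /= fDl addrAC addrK subrr.
- by rewrite !linextU /= fDr addrAC addrK subrr.
Qed.

Lemma tensor_lift_is_zmod_morphism : zmod_morphism tensor_lift.
Proof.
move=> x y; have [x' ->] := tpi_surj x; have [y' ->] := tpi_surj y.
by rewrite -raddfB !tensor_lift_pi raddfB.
Qed.

Lemma tensor_liftE a c : tensor_lift (tens a c) = f a c.
Proof. by rewrite [LHS]tensor_lift_pi linextU. Qed.
End Lift.

Definition tensor_scale (c : K) : tensor -> tensor :=
  tensor_lift (fun a d => tens a (c * d)).

Lemma tensor_scaleE c a d : tensor_scale c (tens a d) = tens a (c * d).
Proof.
by apply: tensor_liftE => *; rewrite ?mulrDr ?tensDl ?tensDr.
Qed.

Lemma tensor_scale_is_zmod_morphism c : zmod_morphism (tensor_scale c).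
Proof.
by apply: tensor_lift_is_zmod_morphism => *; rewrite ?mulrDr ?tensDl ?tensDr.
Qed.

HB.instance Definition _ c := GRing.isZmodMorphism.Build tensor tensor
  (tensor_scale c) (tensor_scale_is_zmod_morphism c).

Fact tensor_scaleA c d x :
  tensor_scale c (tensor_scale d x) = tensor_scale (c * d) x.
Proof.
elim/tensor_ind: x => [|a e|x y hx hy]; rewrite ?raddf0 //.
- by rewrite !tensor_scaleE mulrA.
- by rewrite !tensor_scale_is_zmod_morphism hx hy.
Qed.

Fact tensor_scale1 : left_id 1 tensor_scale.
Proof.
move=> z; elim/tensor_ind: z => [|a e|x y hx hy]; rewrite ?raddf0 //.
- by rewrite tensor_scaleE mul1r.
- by rewrite tensor_scale_is_zmod_morphism hx hy.
Qed.

Fact tensor_scaleDr : right_distributive tensor_scale +%R.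
Proof. by move=> c x y; rewrite raddfD. Qed.

Fact tensor_scaleDl x : {morph tensor_scale^~ x : c d / c + d}.
Proof.
move=> c d; elim/tensor_ind: x => [|a e|x y hx hy]; rewrite ?raddf0 ?addr0 //.
- by rewrite !tensor_scaleE mulrDl tensDr.
- by rewrite !tensor_scale_is_zmod_morphism hx hy opprD addrACA.
Qed.

HB.instance Definition _ := GRing.Zmodule_isLmodule.Build K tensor
  tensor_scaleA tensor_scale1 tensor_scaleDr tensor_scaleDl.

Lemma tensZ c a d : c *: tens a d = tens a (c * d).
Proof. exact: tensor_scaleE. Qed.

(* (a (x) c) (b (x) d) = m a b (x) c d, where m is a biadditive product on A;
   see tensor_mulE. *)
Definition tensor_mul (m : A -> A -> A) (x y : tensor) : tensor :=
  tensor_lift (fun a c => tensor_lift (fun b d => tens (m a b) (c * d)) y) x.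

Section Mul.
Variable m : A -> A -> A.
Hypotheses (mDl : left_distributive m +%R) (mDr : right_distributive m +%R).

Let inner a c := tensor_lift (fun b d => tens (m a b) (c * d)).

Let innerE a c b d : inner a c (tens b d) = tens (m a b) (c * d).
Proof. by apply: tensor_liftE => *; rewrite ?mDr ?mulrDr ?tensDl ?tensDr. Qed.

Let innerB a c : zmod_morphism (inner a c).
Proof.
by apply: tensor_lift_is_zmod_morphism => *; rewrite ?mDr ?mulrDr ?tensDl ?tensDr.
Qed.

Let inner0 a c : inner a c 0 = 0.
Proof. by rewrite -[0 in LHS](subrr (0 : tensor)) innerB subrr. Qed.

Let innerDl a b c y : inner (a + b) c y = inner a c y + inner b c y.
Proof.
elim/tensor_ind: y => [|a' e|x y hx hy]; rewrite ?inner0 ?addr0 //.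
- by rewrite !innerE mDl tensDl.
- by rewrite !innerB hx hy opprD addrACA.
Qed.

Let innerDr a c d y : inner a (c + d) y = inner a c y + inner a d y.
Proof.
elim/tensor_ind: y => [|a' e|x y hx hy]; rewrite ?inner0 ?addr0 //.
- by rewrite !innerE mulrDl tensDr.
- by rewrite !innerB hx hy opprD addrACA.
Qed.

Let mulE a c y : tensor_mul m (tens a c) y = inner a c y.
Proof.
rewrite /tensor_mul tensor_liftE //.
- by move=> *; apply: innerDl.
- by move=> *; apply: innerDr.
Qed.

Lemma tensor_mulE a c b d :
  tensor_mul m (tens a c) (tens b d) = tens (m a b) (c * d).
Proof. by rewrite mulE innerE. Qed.

Lemma tensor_mulBl x y z :
  tensor_mul m (x - y) z = tensor_mul m x z - tensor_mul m y z.
Proof.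
apply: tensor_lift_is_zmod_morphism.
- by move=> *; apply: innerDl.
- by move=> *; apply: innerDr.
Qed.

Lemma tensor_mulBr x y z :
  tensor_mul m x (y - z) = tensor_mul m x y - tensor_mul m x z.
Proof.
elim/tensor_ind: x => [|a c|x x' hx hx'].
- by rewrite -[0](subrr (0 : tensor)) !tensor_mulBl !subrr.
- by rewrite !mulE innerB.
- by rewrite !tensor_mulBl hx hx' !opprD !opprK addrACA.
Qed.
End Mul.

End TensorProduct.

Section Hecke.
(* The 0-Hecke algebra over K: the free associative algebra on n - 1
   generators modulo the two-sided ideal of its defining relations. Generators
   are numbered from 0: 'T_i stands for T_(i+1). *)
Variables (K : comNzRingType) (n : nat).
Local Notation F := {malg K[{fmonom 'I_n.-1}]}.
Local Notation "''T_' i" := (<< @fmu 'I_n.-1 i >> : F)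
  (at level 8, i at level 2, format "''T_' i").

Inductive hecke_rel : F -> Prop :=
| hecke_rel_quad i : hecke_rel ('T_i * 'T_i + 'T_i)
| hecke_rel_braid (i j : 'I_n.-1) : j = i.+1 :> nat ->
    hecke_rel ('T_i * 'T_j * 'T_i - 'T_j * 'T_i * 'T_j)
| hecke_rel_comm (i j : 'I_n.-1) : (i.+1 < j)%N || (j.+1 < i)%N ->
    hecke_rel ('T_i * 'T_j - 'T_j * 'T_i)
| hecke_rel0 : hecke_rel 0
| hecke_relB x y : hecke_rel x -> hecke_rel y -> hecke_rel (x - y)
| hecke_relMl x y : hecke_rel y -> hecke_rel (x * y)
| hecke_relMr x y : hecke_rel x -> hecke_rel (x * y).

Definition hecke_ideal : F -> bool := fun x => `[< hecke_rel x >].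

Fact hecke_ideal_zmod_closed : zmod_closed hecke_ideal.
Proof.
split=> [|x y /asboolP xr /asboolP yr]; apply/asboolP; first exact: hecke_rel0.
exact: hecke_relB.
Qed.

HB.instance Definition _ :=
  GRing.isZmodClosed.Build F hecke_ideal hecke_ideal_zmod_closed.

Definition hecke_idealz : zmodClosed F := GRing.ZmodClosed.clone F hecke_ideal _.

Definition hecke0 : Type := {quot hecke_idealz}.

HB.instance Definition _ := GRing.Zmodule.on hecke0.

Local Notation hpi := (\pi_({quot hecke_idealz}) : F -> hecke0).

Lemma hpi_eq x y : reflect (hpi x = hpi y) `[< hecke_rel (x - y) >].
Proof.
apply: (iffP idP) => [h|/eqP]; first by apply/eqP; rewrite -Quotient.idealrBE.
by rewrite -Quotient.idealrBE.
Qed.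

Lemma hpi_surj (x : hecke0) : exists y, x = hpi y.
Proof. by exists (repr x); rewrite reprK. Qed.

Definition hecke_one : hecke0 := hpi 1.

Definition hecke_mul (x y : hecke0) : hecke0 :=
  hpi (repr (x : {quot hecke_idealz}) * repr (y : {quot hecke_idealz})).

Definition hecke_scale (c : K) (x : hecke0) : hecke0 :=
  hpi (c *: repr (x : {quot hecke_idealz})).

Let hpi_repr x : hecke_rel (repr (\pi_({quot hecke_idealz}) x) - x).
Proof. by apply/asboolP/hpi_eq; rewrite reprK. Qed.

Lemma hecke_mulE x y : hecke_mul (hpi x) (hpi y) = hpi (x * y).
Proof.
apply/hpi_eq/asboolP.
set x' := repr _; set y' := repr _.
have -> : x' * y' - x * y = (x' - x) * y' - (- x) * (y' - y).
  by rewrite mulrBl mulNr opprK mulrBr addrA subrK.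
apply: hecke_relB; first by apply/hecke_relMr/hpi_repr.
exact/hecke_relMl/hpi_repr.
Qed.

Lemma hecke_scaleE c x : hecke_scale c (hpi x) = hpi (c *: x).
Proof.
apply/hpi_eq/asboolP; rewrite -scalerBr -mul_malgC.
exact/hecke_relMl/hpi_repr.
Qed.

Fact hecke_mulA : associative hecke_mul.
Proof.
move=> x y z; have [x' ->] := hpi_surj x; have [y' ->] := hpi_surj y.
by have [z' ->] := hpi_surj z; rewrite !hecke_mulE mulrA.
Qed.

Fact hecke_mul1x : left_id hecke_one hecke_mul.
Proof. by move=> x; have [x' ->] := hpi_surj x; rewrite hecke_mulE mul1r. Qed.

Fact hecke_mulx1 : right_id hecke_one hecke_mul.
Proof. by move=> x; have [x' ->] := hpi_surj x; rewrite hecke_mulE mulr1. Qed.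

Fact hecke_mulDl : left_distributive hecke_mul +%R.
Proof.
move=> x y z; have [x' ->] := hpi_surj x; have [y' ->] := hpi_surj y.
by have [z' ->] := hpi_surj z; rewrite -raddfD !hecke_mulE mulrDl raddfD.
Qed.

Fact hecke_mulDr : right_distributive hecke_mul +%R.
Proof.
move=> x y z; have [x' ->] := hpi_surj x; have [y' ->] := hpi_surj y.
by have [z' ->] := hpi_surj z; rewrite -raddfD !hecke_mulE mulrDr raddfD.
Qed.

Let hecke_rel_eval (e : {rmorphism F -> K}) x :
  (forall i, e 'T_i = 0) -> hecke_rel x -> e x = 0.
Proof.
move=> e0; elim=> [i|i j _|i j _||y z _ hy _ hz|y z _ hz|y z _ hy].
- by rewrite rmorphD rmorphM e0 mulr0 addr0.
- by rewrite rmorphB !rmorphM !e0 !mulr0 subrr.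
- by rewrite rmorphB !rmorphM !e0 !mulr0 subrr.
- exact: rmorph0.
- by rewrite rmorphB hy hz subrr.
- by rewrite rmorphM hz mulr0.
- by rewrite rmorphM hy mul0r.
Qed.

Fact hecke_one_neq0 : hecke_one != 0.
Proof.
apply/negP => /eqP; rewrite /hecke_one -(raddf0 hpi) => /hpi_eq/asboolP.
rewrite subr0 => h.
have /eqP : mcoeff (@mone {fmonom 'I_n.-1}) (1 : F) = 0.
  by apply: hecke_rel_eval h => i; rewrite [LHS]mcoeffU1 fmP fmU fm1.
by rewrite rmorph1 oner_eq0.
Qed.

HB.instance Definition _ := GRing.Zmodule_isNzRing.Build hecke0
  hecke_mulA hecke_mul1x hecke_mulx1 hecke_mulDl hecke_mulDr hecke_one_neq0.

Fact hecke_scaleA c d x :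
  hecke_scale c (hecke_scale d x) = hecke_scale (c * d) x.
Proof. by have [x' ->] := hpi_surj x; rewrite !hecke_scaleE scalerA. Qed.

Fact hecke_scale1 : left_id 1 hecke_scale.
Proof. by move=> x; have [x' ->] := hpi_surj x; rewrite hecke_scaleE scale1r. Qed.

Fact hecke_scaleDr : right_distributive hecke_scale +%R.
Proof.
move=> c x y; have [x' ->] := hpi_surj x; have [y' ->] := hpi_surj y.
by rewrite -raddfD !hecke_scaleE scalerDr raddfD.
Qed.

Fact hecke_scaleDl x : {morph hecke_scale^~ x : c d / c + d}.
Proof.
by move=> c d; have [x' ->] := hpi_surj x; rewrite !hecke_scaleE scalerDl raddfD.
Qed.

HB.instance Definition _ := GRing.Zmodule_isLmodule.Build K hecke0
  hecke_scaleA hecke_scale1 hecke_scaleDr hecke_scaleDl.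

Fact hecke_scaleAl (c : K) (x y : hecke0) : c *: (x * y) = (c *: x) * y.
Proof.
have [x' ->] := hpi_surj x; have [y' ->] := hpi_surj y.
rewrite -[LHS]/(hecke_scale c (hecke_mul (hpi x') (hpi y'))).
rewrite -[RHS]/(hecke_mul (hecke_scale c (hpi x')) (hpi y')).
by rewrite hecke_mulE !hecke_scaleE hecke_mulE scalerAl.
Qed.

HB.instance Definition _ := GRing.Lmodule_isLalgebra.Build K hecke0 hecke_scaleAl.

Fact hecke_scaleAr (c : K) (x y : hecke0) : c *: (x * y) = x * (c *: y).
Proof.
have [x' ->] := hpi_surj x; have [y' ->] := hpi_surj y.
rewrite -[LHS]/(hecke_scale c (hecke_mul (hpi x') (hpi y'))).
rewrite -[RHS]/(hecke_mul (hpi x') (hecke_scale c (hpi y'))).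
rewrite hecke_mulE !hecke_scaleE hecke_mulE; congr (hpi _).
apply/malgP => m; rewrite mcoeffZ (mcoeffMl x' y').
rewrite (mcoeffMlw _ (fsubset_refl _) (msuppZ_le c y')) mulr_sumr.
apply: eq_bigr => i _; rewrite mulr_sumr; apply: eq_bigr => j _.
by rewrite mcoeffZ mulrnAr mulrCA.
Qed.

HB.instance Definition _ := GRing.Lalgebra_isAlgebra.Build K hecke0 hecke_scaleAr.

Definition hecke_T (i : 'I_n.-1) : hecke0 := hpi 'T_i.

End Hecke.

Section Flags.
Variables (k : closedFieldType) (V : vectType k).
Local Notation N := (\dim {: V}).

Definition is_flag (f : {ffun 'I_N.+1 -> {vspace V}}) : bool :=
  [&& f ord0 == 0%VS, f ord_max == fullv &
      [forall i : 'I_N.+1, forall j : 'I_N.+1, (i <= j)%N ==> (f i <= f j)%VS]].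

Definition flag : Type := {f : {ffun 'I_N.+1 -> {vspace V}} | is_flag f}.

Definition step (f : flag) (i : 'I_N.+1) : {vspace V} := val f i.

Definition complete (f : flag) : Prop := forall i, \dim (step f i) = i.

Definition translate (g : 'End(V)) (f f' : flag) : Prop :=
  forall i, step f' i = (g @: step f i)%VS.

Definition gl_orbit (x : flag * flag) : set (flag * flag) :=
  [set y | exists g : 'End(V),
    [/\ lker g == 0%VS, translate g x.1 y.1 & translate g x.2 y.2]].

Definition is_orbit (e : set (flag * flag)) : bool :=
  `[< exists x, e = gl_orbit x >].

Definition orbit : Type := {e : set (flag * flag) | is_orbit e}.

HB.instance Definition _ := Choice.on orbit.

(* The subsets S(e, e') of pairs composable through e and e'. *)
Definition composites (e e' : orbit) : set (flag * flag) :=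
  [set x | exists f, val e (x.1, f) /\ val e' (f, x.2)].

(* The Zariski topology on pairs of flags: the variety of flags sits in a
   product of Grassmannians, and a Grassmannian in a projective space by its
   Pluecker coordinates. The coordinates of a subspace with basis b are indexed
   by all sets J of columns, with value 0 when #|J| is not the dimension, so
   that subspaces of different dimensions lie in disjoint closed pieces of one
   projective space. *)
Definition minor (b : seq V) (J : {set 'I_N}) : k :=
  if #|J| == size b
  then \det (\matrix_(r < #|J|, c < #|J|) coord (vbasis {: V}) (enum_val c) b`_r)
  else 0.

Definition coord_index : finType := (('I_N.+1 + 'I_N.+1) * {set 'I_N})%type.

Definition pluecker (b1 b2 : 'I_N.+1 -> seq V) (j : coord_index) : k :=
  match j.1 with
  | inl i => minor (b1 i) j.2
  | inr i => minor (b2 i) j.2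
  end.

(* Changing the bases rescales the coordinates of each step independently;
   asking for the equivalence with all choices of bases expresses that Z is
   the zero locus of P in the product of projective spaces. *)
Definition zariski_closed (Z : set (flag * flag)) : Prop :=
  exists P : set (mpoly.mpoly #|coord_index| k),
  forall (x : flag * flag) (b1 b2 : 'I_N.+1 -> seq V),
    (forall i, basis_of (step x.1 i) (b1 i)) ->
    (forall i, basis_of (step x.2 i) (b2 i)) ->
    (Z x <-> forall p, P p ->
       mpoly.meval (fun j => pluecker b1 b2 (enum_val j)) p = 0).

Definition zariski_open (U : set (flag * flag)) : Prop := zariski_closed (~` U).

Definition open_in (S O : set (flag * flag)) : Prop :=
  exists2 U, zariski_open U & O = S `&` U.

Definition open_orbits (e e' : orbit) : set orbit :=
  [set o | val o `<=` composites e e' /\ open_in (composites e e') (val o)].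

(* The underlying abelian group of G(n,n). When S(e, e') is nonempty,
   open_orbits e e' has exactly one element: the default e of xget only makes
   the definition total. *)
Local Notation generic_alg := {malg int[orbit]}.

Definition star_basis (e e' : orbit) : generic_alg :=
  if `[< composites e e' !=set0 >] then << xget e (open_orbits e e') >> else 0.

Definition star (x y : generic_alg) : generic_alg :=
  linext (fun e => linext (star_basis e) y) x.

Let starE x y :
  star x y = \sum_(e <- msupp x) linext (star_basis e) y *~ x@_e.
Proof. by []. Qed.

Lemma star_DBl x y z : star (x - y) z = star x z - star y z.
Proof. exact: linextB. Qed.

Lemma star_DBr x y z : star x (y - z) = star x y - star x z.
Proof.
rewrite !starE -sumrB; apply: eq_bigr => e _.
by rewrite -mulrzBl linextB.
Qed.

Lemma star_Dl x y z : star (x + y) z = star x z + star y z.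
Proof. exact: linextD. Qed.

Lemma star_Dr x y z : star x (y + z) = star x y + star x z.
Proof.
rewrite !starE -big_split; apply: eq_bigr => e _ /=.
by rewrite -mulrzDl linextD.
Qed.

Lemma star_U e e' : star << e >> << e' >> = star_basis e e'.
Proof. by rewrite /star !linextU. Qed.

Fact std_flag_subproof :
  is_flag [ffun i : 'I_N.+1 => <<take i (vbasis {: V})>>%VS].
Proof.
apply/and3P; split; rewrite ?ffunE ?take0 ?span_nil //.
  by rewrite take_oversize ?size_tuple //= (span_basis (vbasisP _)).
apply/forallP => i; apply/forallP => j; apply/implyP => le_ij; rewrite !ffunE.
apply: sub_span => v; rewrite -(subnKC le_ij) takeD mem_cat => -> //.
Qed.

Definition std_flag : flag := Sub _ std_flag_subproof.

Lemma std_flag_complete : complete std_flag.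
Proof.
move=> i; rewrite /step /= ffunE.
have fr : free (take i (vbasis {: V})).
  have := basis_free (vbasisP {: V}).
  by rewrite -{1}(cat_take_drop i (vbasis _)) cat_free => /and3P[].
move/eqP: fr => ->; rewrite size_takel // size_tuple -ltnS //.
Qed.

Fact gl_orbit_is_orbit x : is_orbit (gl_orbit x).
Proof. by apply/asboolP; exists x. Qed.

Definition orbit_of (x : flag * flag) : orbit := Sub _ (gl_orbit_is_orbit x).

(* The idempotent k_d for d = (1, ..., 1). *)
Definition k_unit : generic_alg := << orbit_of (std_flag, std_flag) >>.

Definition H0_pred : generic_alg -> bool :=
  fun x => `[< exists y, x = star (star k_unit y) k_unit >].

Fact H0_zmod_closed : zmod_closed H0_pred.
Proof.
split=> [|x y /asboolP[x' ->] /asboolP[y' ->]]; apply/asboolP.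
  by exists 0; rewrite -(subrr (0 : generic_alg)) star_DBr star_DBl !subrr.
by exists (x' - y'); rewrite star_DBr star_DBl.
Qed.

HB.instance Definition _ :=
  GRing.isZmodClosed.Build generic_alg H0_pred H0_zmod_closed.

Definition H0 : Type := {x : generic_alg | H0_pred x}.

HB.instance Definition _ := SubChoice.on H0.
HB.instance Definition _ := [SubChoice_isSubZmodule of H0 by <:].

Lemma flagP (f f' : flag) : (forall i, step f i = step f' i) -> f = f'.
Proof. by move=> h; apply/val_inj/ffunP. Qed.

Lemma step_le (f : flag) (i j : 'I_N.+1) : (i <= j)%N -> (step f i <= step f j)%VS.
Proof. by have /and3P[_ _ /'forall_'forall_implyP] := valP f; apply. Qed.

Lemma step0 (f : flag) : step f ord0 = 0%VS.
Proof. by have /and3P[/eqP] := valP f. Qed.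

Lemma translate_refl f : translate \1%VF f f.
Proof. by move=> i; rewrite lim1g. Qed.

Lemma translate_inv (g : 'End(V)) f f' : lker g == 0%VS ->
  translate g f f' -> translate (g^-1)%VF f' f.
Proof.
by move=> g0 h i; rewrite h -limg_comp lker0_compVf // lim1g.
Qed.

Lemma translate_comp (g g' : 'End(V)) f f' f'' :
  translate g f f' -> translate g' f' f'' -> translate (g' \o g)%VF f f''.
Proof. by move=> h h' i; rewrite h' h limg_comp. Qed.

Lemma lker0_inv (g : 'End(V)) : lker g == 0%VS -> lker (g^-1)%VF == 0%VS.
Proof. by move=> g0; apply/lker0P/(can_inj (lker0_lfunVK g0)). Qed.

Lemma lker0_comp (g g' : 'End(V)) :
  lker g == 0%VS -> lker g' == 0%VS -> lker (g' \o g)%VF == 0%VS.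
Proof.
move=> /lker0P gi /lker0P gi'; apply/lker0P => x y.
by rewrite !comp_lfunE => /gi' /gi.
Qed.

Lemma gl_orbit_refl x : gl_orbit x x.
Proof.
exists \1%VF; split; try exact: translate_refl.
by apply/lker0P => u v; rewrite !id_lfunE.
Qed.

Lemma gl_orbit_sym x y : gl_orbit x y -> gl_orbit y x.
Proof.
case=> g [g0 h1 h2]; exists (g^-1)%VF.
by split; [exact: lker0_inv | exact: translate_inv | exact: translate_inv].
Qed.

Lemma gl_orbit_trans x y z : gl_orbit x y -> gl_orbit y z -> gl_orbit x z.
Proof.
case=> g [g0 h1 h2] [g' [g0' h1' h2']]; exists (g' \o g)%VF.
by split; [exact: lker0_comp | apply: translate_comp h1' | apply: translate_comp h2'].
Qed.

Lemma orbitE (e : orbit) x : val e x -> val e = gl_orbit x.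
Proof.
have /asboolP[y ->] := valP e => yx; apply/seteqP; split=> z.
  by move=> yz; apply: gl_orbit_trans yz; apply: gl_orbit_sym.
exact: gl_orbit_trans.
Qed.

Lemma orbit_inhabited (e : orbit) : exists x, val e x.
Proof.
by have /asboolP[y ->] := valP e; exists y; apply: gl_orbit_refl.
Qed.

Lemma orbit_inj (e e' : orbit) x : val e x -> val e' x -> e = e'.
Proof. by move=> ex ex'; apply: val_inj; rewrite (orbitE ex) (orbitE ex'). Qed.

Lemma translate_complete (g : 'End(V)) f f' : lker g == 0%VS ->
  translate g f f' -> complete f -> complete f'.
Proof.
move=> /eqP g0 h cf i; rewrite h -[RHS](cf i); apply: limg_dim_eq.
by rewrite g0 capv0.
Qed.

Lemma complete_transitive f : complete f ->
  exists2 g : 'End(V), lker g == 0%VS & translate g std_flag f.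
Proof.
move=> cf.
have hv (i : 'I_N) : exists v, (v \in step f (lift ord0 i)) /\
    (v \notin step f (widen_ord (leqnSn N) i)).
  apply/not_existsP => h.
  have /dimvS : (step f (lift ord0 i) <= step f (widen_ord (leqnSn N) i))%VS.
    by apply/subvP => v vi; apply: contrapT => /negP vn; apply: (h v).
  by rewrite !cf /= ltnn.
have [v hv'] := choice hv.
pose s := mkseq (fun j => oapp v 0 (insub j : option 'I_N)) N.
have span_take j (hj : (j < N.+1)%N) : <<take j s>>%VS = step f (Ordinal hj).
  elim: j hj => [|j IHj] hj.
    rewrite take0 span_nil -(step0 f); congr step; exact: val_inj.
  have hj' : (j < N.+1)%N by apply: ltn_trans hj.
  have jN : (j < N)%N by [].
  rewrite (take_nth 0) ?size_mkseq // -cats1 span_cat span_seq1 (IHj hj').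
  rewrite nth_mkseq // insubT /=.
  have [v1 v2] := hv' (Ordinal jN).
  have e1 : lift ord0 (Ordinal jN) = Ordinal hj by apply: val_inj.
  have e2 : widen_ord (leqnSn N) (Ordinal jN) = Ordinal hj' by apply: val_inj.
  move: v1 v2; rewrite e1 e2; set w := v _ => v1 v2.
  apply/eqP; rewrite eqEdim subv_add -memvE v1 andbT step_le //= cf.
  rewrite ltnNge -[X in (_ <= X)%N](cf (Ordinal hj')); apply/negP => le.
  have := dimv_leqif_sup (addvSl (step f (Ordinal hj')) <[w]>%VS).
  case=> _; rewrite eqn_leq le (dimvS (addvSl _ _)) /= subv_add subvv /= => /esym.
  by rewrite -memvE (negPf v2).
have szs : size s = N by rewrite size_mkseq.
have span_s : <<s>>%VS = {: V}%VS.
  rewrite -[s](@take_oversize _ N) ?szs // (span_take N (ltnSn N)).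
  by apply/eqP; rewrite eqEdim subvf cf /=.
have free_b := basis_free (vbasisP {: V}).
have [g hg] := linear_of_free (vbasis {: V}) s.
have {}hg : map (linfun g) (vbasis {: V}) = s.
  by rewrite -[RHS]hg ?size_tuple ?szs //; apply: eq_map => u; rewrite lfunE.
have tr : translate (linfun g) std_flag f.
  move=> i; rewrite {2}/step /= ffunE limg_span map_take hg.
  by rewrite (span_take i (ltn_ord i)); congr step; apply: val_inj.
exists (linfun g) => //; rewrite -dimv_eq0.
have := limg_ker_dim (linfun g) {: V}; rewrite capfv.
rewrite -[X in (_ @: X)%VS](span_basis (vbasisP {: V})) limg_span hg span_s.
by move/eqP; rewrite -[X in _ == X]add0n eqn_add2r.
Qed.

Definition complete_pairs (e : orbit) : Prop :=
  forall x, val e x -> complete x.1 /\ complete x.2.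

Lemma completeP (e : orbit) x :
  val e x -> complete x.1 -> complete x.2 -> complete_pairs e.
Proof.
move=> ex c1 c2 y; rewrite (orbitE ex) => -[g [g0 h1 h2]]; split.
  exact: translate_complete h1 c1.
exact: translate_complete h2 c2.
Qed.

Local Notation kd := (orbit_of (std_flag, std_flag)).

Lemma kdP x : val kd x <-> x.1 = x.2 /\ complete x.1.
Proof.
split=> [[g /= [g0 h1 h2]]|].
  split; first by apply: flagP => i; rewrite h1 h2.
  exact: translate_complete h1 std_flag_complete.
case: x => f f' /= [<- cf]; have [g g0 tr] := complete_transitive cf.
by exists g.
Qed.

Lemma zariski_openT : zariski_open setT.
Proof.
exists [set (1 : mpoly.mpoly #|coord_index| k)] => x b1 b2 _ _; rewrite setCT; split=> // /(_ _ erefl) /eqP.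
by rewrite mpoly.meval1 oner_eq0.
Qed.

Lemma star_basis_orbit (e e' o : orbit) :
  composites e e' = val o -> star_basis e e' = << o >>.
Proof.
move=> h; rewrite /star_basis h asboolT; last exact: orbit_inhabited.
have oo : open_orbits e e' o.
  rewrite /open_orbits h /=; split=> //.
  by exists setT; [exact: zariski_openT | rewrite setIT].
congr << _ >>; have [so _] := xgetPex e (ex_intro _ o oo).
have [x xo] := orbit_inhabited (xget e (open_orbits e e')).
have ox : val o x by rewrite -h; apply: so.
exact: orbit_inj xo ox.
Qed.

Lemma star_basis0 (e e' : orbit) :
  (forall x, ~ composites e e' x) -> star_basis e e' = 0.
Proof. by move=> h; rewrite /star_basis asboolF // => -[x /h]. Qed.

Lemma kd_star (e : orbit) x : val e x ->
  star_basis kd e = if `[< complete x.1 >] then << e >> else 0.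
Proof.
move=> ex; case: asboolP => c.
  apply: star_basis_orbit; apply/seteqP; split=> [y [f [/kdP[/= <- _]]]|y ey].
    by case: y.
  exists y.1; split; last by case: y ey.
  apply/kdP; split=> //=; move: ey; rewrite (orbitE ex) => -[g [g0 h1 _]].
  exact: translate_complete h1 c.
apply: star_basis0 => y [f [/kdP[/= <- c'] ey]]; apply: c.
move: ex; rewrite (orbitE ey) => -[g [g0 h1 _]].
exact: translate_complete h1 c'.
Qed.

Lemma star_kd (e : orbit) x : val e x ->
  star_basis e kd = if `[< complete x.2 >] then << e >> else 0.
Proof.
move=> ex; case: asboolP => c.
  apply: star_basis_orbit; apply/seteqP; split=> [y [f [ey /kdP[/= fe _]]]|y ey].
    by move: ey; rewrite fe; case: y {fe}.
  exists y.2; split; first by case: y ey.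
  apply/kdP; split=> //=; move: ey; rewrite (orbitE ex) => -[g [g0 _ h1]].
  exact: translate_complete h1 c.
apply: star_basis0 => y [f [ey /kdP[/= fe c']]]; apply: c.
move: ex; rewrite (orbitE ey) => -[g [g0 _ h1]].
exact: translate_complete h1 c'.
Qed.

Lemma star_basis_complete (e e' : orbit) : complete_pairs e -> complete_pairs e' ->
  star_basis e e' = 0 \/ exists2 o, star_basis e e' = << o >> & complete_pairs o.
Proof.
move=> ce ce'; rewrite /star_basis; case: asboolP => _; [right|by left].
exists (xget e (open_orbits e e')) => //.
case: xgetP => // o _ [so _] x /so[f [/ce[/= c1 _] /ce'[/= _ c2]]]; split=> //.
Qed.

Let monalg_sum (x : generic_alg) : x = \sum_(e <- msupp x) << e >> *~ x@_e.
Proof.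
rewrite {1}[x]monalgE; apply: eq_bigr => e _.
have PUn n : << n%:Z *g e >> = << e >> *~ n%:Z :> generic_alg.
  elim: n => [|n IHn]; first by rewrite monalgU0.
  by rewrite intS monalgUD IHn mulrzDr mulr1z.
case: (x@_e) => m; first exact: PUn.
by rewrite NegzE monalgUN PUn mulrNz.
Qed.

(* H_0(n) is the span of the orbits of pairs of complete flags. *)
Lemma H0P x : H0_pred x <-> forall e, e \in msupp x -> complete_pairs e.
Proof.
split=> [/asboolP[y ->]|h].
  elim/malg_int_ind: y => [|e|y z hy hz] e'.
  - rewrite -(subrr (0 : generic_alg)) star_DBr star_DBl !subrr.
    by rewrite msupp0 inE.
  - rewrite star_U; have [x' ex'] := orbit_inhabited e.
    rewrite (kd_star ex'); case: asboolP => c1; last first.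
      by rewrite /star raddf0 msupp0 inE.
    rewrite star_U (star_kd ex'); case: asboolP => c2; last by rewrite msupp0 inE.
    by rewrite msuppU oner_eq0 inE => /eqP ->; apply: completeP c1 c2.
  - rewrite star_DBr star_DBl => /(fsubsetP (msuppB_le _ _)).
    by rewrite inE => /orP[/hy|/hz].
have kx : star k_unit x = x.
  rewrite /star /k_unit linextU [RHS]monalg_sum /linext.
  apply: eq_big_seq => e /h ce; have [z ez] := orbit_inhabited e.
  by rewrite (kd_star ez) asboolT //; case: (ce _ ez).
apply/asboolP; exists x; rewrite kx {1}[x]monalg_sum starE.
apply: eq_big_seq => e /h ce; have [z ez] := orbit_inhabited e.
rewrite linextU (star_kd ez) asboolT //; by case: (ce _ ez).
Qed.

Lemma complete_H0 (e : orbit) : complete_pairs e -> H0_pred << e >>.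
Proof. by move=> ce; apply/H0P => e'; rewrite msuppU oner_eq0 inE => /eqP ->. Qed.

Fact H0_star_closed x y : H0_pred x -> H0_pred y -> H0_pred (star x y).
Proof.
move=> /H0P hx /H0P hy; rewrite /star /linext big_seq.
apply: rpred_sum => e /hx ce; apply: rpredMz; rewrite big_seq.
apply: rpred_sum => e' /hy ce'; apply: rpredMz.
have [->|[o -> co]] := star_basis_complete ce ce'; first exact: rpred0.
exact: complete_H0.
Qed.

Fact H0_k_unit : H0_pred k_unit.
Proof.
apply: complete_H0; apply: (@completeP _ (std_flag, std_flag));
  [exact: gl_orbit_refl | exact: std_flag_complete..].
Qed.

Definition H0_one : H0 := Sub k_unit H0_k_unit.

Definition H0_mul (x y : H0) : H0 :=
  Sub (star (val x) (val y)) (H0_star_closed (valP x) (valP y)).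

Fact H0_mulDl : left_distributive H0_mul +%R.
Proof. by move=> x y z; apply: val_inj; rewrite /= star_Dl. Qed.

Fact H0_mulDr : right_distributive H0_mul +%R.
Proof. by move=> x y z; apply: val_inj; rewrite /= star_Dr. Qed.

End Flags.

(* Main.v *)
Require Import Defs.
From HB Require Import structures.
From mathcomp Require Import all_boot all_order fingroup perm all_algebra.
From mathcomp Require Import generic_quotient ring_quotient.
From mathcomp Require Import finmap mpoly xfinmap monalg.
From mathcomp Require Import boolp classical_sets reals complex zify.

Set Implicit Arguments.
Unset Strict Implicit.
Unset Printing Implicit Defensive.

Import GRing.Theory.
Local Open Scope ring_scope.

(** Both algebras are the monoid algebra of the 0-Hecke monoid.

    On the geometric side, the product of two orbits of pairs of complete flags
    is again an orbit, so that these orbits form a monoid [corbit V]. Two facts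
    make it computable. First, the variety of chains of flags with prescribed
    consecutive relative positions is irreducible: two chains differ by moving
    their flags with [g], [g], [g * s_1], [g * s_1 * s_2], ..., where [s_i]
    stabilizes the [i]-th flag, and the segments from the identity to [g] and to
    the [s_i] give a polynomial curve of chains between them
    ([chain_irreducible]). Second, a lower bound on [dim (f_i + f'_j)] is a
    Zariski-open condition ([zariski_open_dim_addv]), because a subspace is
    spanned by vectors whose coordinates are Pluecker coordinates. Hence on a
    variety of chains all the dimensions [dim (f_i + f'_j)] of the end flags are
    maximal together; as these dimensions determine the orbit of a pair of
    complete flags ([same_capd_orbit]), the open orbit exists, is unique, and is
    recognized by maximality ([corbit_mul_generic]). Associativity follows, since
    a generic chain of four flags has generic subchains ([corbit3_mul]).

    Let [gen i] be the orbit of the pairs that differ exactly at the step [i + 1].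
    These orbits are idempotent, commute when their indices are not neighbours,
    and satisfy the braid relation since both sides consist of the pairs in
    general position inside [f_(s+2) / f_(s-1)] ([gen_relations]).

    These relations bring every word to a normal form, a concatenation of one
    descending word [m, m - 1, ..., j] for each [m] ([hecke_normal_form]). The
    orbits of the normal forms are distinct and exhaust the monoid
    ([normal_form_inj], [normal_form_surj]): for a pair [(f, f')] of flags that
    agree above the step [m + 1], the last descending word is given by the number
    of nonzero steps of [f'] inside [f_(m+1)], and the flag [g] cut out by [f'] on
    [f_(m+1)], completed by the steps of [f], is the only possible intermediate
    flag; induction applies to [(f, g)], which agree above the step [m]. So
    equal orbits come from congruent words.

    On the algebraic side, the elements [- T_i] are idempotents that satisfy the
    same relations. Mapping the orbit of a word in the [gen i] to the product of
    the [- T_i] is therefore well defined and multiplicative ([orbit_mapM]),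
    hence a morphism of algebras on the tensor product. Its inverse sends a word
    in the [T_i] to the orbit of the word with the sign of its length, and it
    kills the defining ideal ([free_lift_word_tensor_rel]). *)

(** * Polynomial functions *)

Section SubalgebraOfFunctions.
Variables (K : comNzRingType) (X : Type).

Definition fun_subalgebra (A : (X -> K) -> Prop) : Prop :=
  [/\ forall c, A (fun=> c),
      forall f g, A f -> A g -> A (fun x => f x + g x) &
      forall f g, A f -> A g -> A (fun x => f x * g x)].

Variable A : (X -> K) -> Prop.
Hypothesis subA : fun_subalgebra A.

Let ext f g : f =1 g -> A f -> A g.
Proof. by move=> /funext ->. Qed.

Lemma fun_subalgebra_sum (I : Type) (r : seq I) (P : pred I) (f : I -> X -> K) :
  (forall i, A (f i)) -> A (fun x => \sum_(i <- r | P i) f i x).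
Proof.
have [Acst AD _] := subA; move=> Af; elim: r => [|i r IHr].
  by apply: ext (Acst 0) => x; rewrite big_nil.
case Pi: (P i); last by apply: ext IHr => x; rewrite big_cons Pi.
by apply: ext (AD _ _ (Af i) IHr) => x; rewrite big_cons Pi.
Qed.

Lemma fun_subalgebra_prod (I : Type) (r : seq I) (P : pred I) (f : I -> X -> K) :
  (forall i, A (f i)) -> A (fun x => \prod_(i <- r | P i) f i x).
Proof.
have [Acst _ AM] := subA; move=> Af; elim: r => [|i r IHr].
  by apply: ext (Acst 1) => x; rewrite big_nil.
case Pi: (P i); last by apply: ext IHr => x; rewrite big_cons Pi.
by apply: ext (AM _ _ (Af i) IHr) => x; rewrite big_cons Pi.
Qed.

Lemma fun_subalgebra_det m (M : X -> 'M[K]_m) :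
  (forall i j, A (fun x => M x i j)) -> A (fun x => \det (M x)).
Proof.
have [Acst _ AM] := subA; move=> AMij.
have Aterm (s : 'S_m) : A (fun x => (-1) ^+ s * \prod_i M x i (s i)).
  by apply: AM; [exact: Acst | exact: fun_subalgebra_prod].
exact: ext (fun_subalgebra_sum (index_enum _) xpredT Aterm).
Qed.

Lemma fun_subalgebra_meval m (p : mpoly.mpoly m K) (v : 'I_m -> X -> K) :
  (forall i, A (v i)) -> A (fun x => mpoly.meval (v^~ x) p).
Proof.
have [Acst _ AM] := subA; move=> Av.
have Apow i j : A (fun x => v i x ^+ j).
  have := fun_subalgebra_prod (index_enum 'I_j) xpredT (fun=> Av i).
  by apply: ext => x; rewrite prodr_const card_ord.
have Aterm (u : mpoly.multinom m) : A (fun x =>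
    mpoly.mcoeff u p * \prod_i v i x ^+ mpoly.fun_of_multinom u i).
  apply: AM; first exact: Acst.
  exact: (fun_subalgebra_prod (index_enum _) xpredT (fun i => Apow i _)).
apply: ext (fun_subalgebra_sum (mpoly.msupp p) xpredT Aterm) => x.
by rewrite mpoly.mevalE.
Qed.

End SubalgebraOfFunctions.

Definition poly_fun (K : comNzRingType) (f : K -> K) : Prop :=
  exists p : {poly K}, forall t, f t = p.[t].

Lemma poly_fun_subalgebra (K : comNzRingType) : fun_subalgebra (@poly_fun K).
Proof.
split=> [c|f g [p fp] [q gq]|f g [p fp] [q gq]].
- by exists c%:P => t; rewrite hornerC.
- by exists (p + q) => t; rewrite hornerD fp gq.
- by exists (p * q) => t; rewrite hornerM fp gq.
Qed.

(** A nonzero polynomial over an algebraically closed field has a non-root,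
    so properties that hold off the roots of a nonzero polynomial can be
    combined. *)
Definition generically (K : fieldType) (P : K -> Prop) : Prop :=
  exists2 p : {poly K}, p != 0 & forall t, p.[t] != 0 -> P t.

Section Generically.
Variable K : closedFieldType.
Implicit Types P Q : K -> Prop.

Lemma generically_and P Q :
  generically P -> generically Q -> generically (fun t => P t /\ Q t).
Proof.
move=> [p p0 Pp] [q q0 Qq]; exists (p * q); first by rewrite mulf_neq0.
by move=> t; rewrite hornerM mulf_eq0 negb_or => /andP[/Pp ? /Qq].
Qed.

Lemma generically_sub P Q : (forall t, P t -> Q t) -> generically P -> generically Q.
Proof. by move=> PQ [p p0 Pp]; exists p => // t /Pp /PQ. Qed.

Lemma generically_ex P : generically P -> exists t, P t.
Proof. by move=> [p p0 Pp]; have /closed_nonrootP[t /Pp] := p0; exists t. Qed.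

Lemma generically_neq0 (f : K -> K) t0 :
  poly_fun f -> f t0 != 0 -> generically (fun t => f t != 0).
Proof.
move=> [p fp] f0; exists p => [|t]; last by rewrite fp.
by apply: contraNneq f0; rewrite fp => ->; rewrite horner0.
Qed.

End Generically.

(** * Zariski-open sets of pairs of flags *)

Section Zariski.
Variables (k : closedFieldType) (V : vectType k).
Local Notation N := (\dim {: V}).
Local Notation flag := (flag V).

Lemma zariski_closedU (Z Z' : set (flag * flag)) :
  zariski_closed Z -> zariski_closed Z' -> zariski_closed (Z `|` Z')%classic.
Proof.
move=> [P ZP] [P' ZP']; exists [set r | exists p p', [/\ P p, P' p' & r = p * p']]%classic.
move=> x b1 b2 b1P b2P; split=> [|h].
  case=> [/(ZP _ _ _ b1P b2P) h|/(ZP' _ _ _ b1P b2P) h] _ [p [p' [Pp Pp' ->]]].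
    by rewrite mpoly.mevalM (h p) // mul0r.
  by rewrite mpoly.mevalM (h p') // mulr0.
have [Zx|nZx] := pselect (Z x); [by left|right].
apply/(ZP' _ _ _ b1P b2P) => p' Pp'; apply: contrapT => /eqP p'0; apply: nZx.
apply/(ZP _ _ _ b1P b2P) => p Pp.
have /eqP := h (p * p') (ex_intro _ p (ex_intro _ p' (And3 Pp Pp' erefl))).
by rewrite mpoly.mevalM mulf_eq0 (negPf p'0) orbF => /eqP.
Qed.

Lemma zariski_openI (U U' : set (flag * flag)) :
  zariski_open U -> zariski_open U' -> zariski_open (U `&` U')%classic.
Proof. by rewrite /zariski_open setCI; apply: zariski_closedU. Qed.

Lemma zariski_open_all (I : Type) (r : seq I) (U : I -> set (flag * flag)) :
  (forall i, zariski_open (U i)) ->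
  zariski_open [set x | all (fun i => `[< U i x >]) r]%classic.
Proof.
move=> oU; elim: r => [|i r IHr].
  by rewrite (_ : [set _ | _]%classic = setT); [exact: zariski_openT | apply/seteqP].
rewrite (_ : [set _ | _]%classic = U i `&` [set x | all (fun i => `[< U i x >]) r])%classic.
  exact: zariski_openI.
by apply/seteqP; split=> x /=; [case/andP=> /asboolP | case=> /asboolP -> ->].
Qed.

End Zariski.

(** * Relative position is a Zariski-open condition *)

Section Pluecker.
Import VectorInternalTheory passmx.
Variables (k : closedFieldType) (V : vectType k).
Local Notation N := (\dim {: V}).
Local Notation flag := (flag V).
Local Notation e := (vbasis {: V}).
Implicit Types (b : seq V).

Definition coord_mx a b : 'M[k]_(a, N) := \matrix_(r < a, i < N) coord e i b`_r.

Lemma dim_span_coord_mx b : \dim <<b>> = \rank (coord_mx (size b) b).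
Proof.
pose T := lin1_mx (rVof e \o r2v); pose T' := lin1_mx (v2r \o vecof e).
have TT' : T *m T' = 1%:M.
  apply/row_matrixP => i; rewrite rowE mulmxA !mul_rV_lin1 /= (rVofK (vbasisP _)).
  by rewrite r2vK rowE mulmx1.
have Tfree : row_free T by apply/row_freeP; exists T'.
have -> : coord_mx (size b) b = (b2mx (in_tuple b)) *m T.
  apply/row_matrixP => r; rewrite row_mul rowK mul_rV_lin1 /= v2rK.
  by apply/rowP => i; rewrite !mxE (tnth_nth 0).
by rewrite (mxrankMfree _ Tfree) unlock /dimv genmxE.
Qed.

Lemma coord_mx_cat a a' b b' : size b = a ->
  coord_mx (a + a') (b ++ b') = col_mx (coord_mx a b) (coord_mx a' b').
Proof.
move=> <-; apply/matrixP => r i; rewrite !mxE nth_cat.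
by case: (splitP r) => r' ->; rewrite !mxE // addKn.
Qed.

Lemma minor_enum a b (J : {set 'I_N}) (Ja : a = #|J|) : size b = a ->
  minor b J = \det (colsub (fun t => enum_val (cast_ord Ja t)) (coord_mx a b)).
Proof.
move=> sb; subst a; rewrite /minor sb eqxx; congr (\det _).
by apply/matrixP => r t; rewrite !mxE cast_ord_id.
Qed.

(** A list of distinct columns is a permutation of the enumeration of its set,
    whence the sign [eps]; when a column is repeated, [eps] is zero. Setting the
    right-hand side to zero for families of the wrong size agrees with [minor]
    and lets the same polynomials serve for flags that are not complete. *)
Lemma det_colsub_minor a (c : 'I_a -> 'I_N) :
  exists eps J, forall b,
    eps * minor b J = if size b == a then \det (colsub c (coord_mx a b)) else 0.
Proof.
have [c_inj|c_ninj] := pselect (injective c); last first.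
  exists 0, finset.set0 => b; rewrite mul0r; case: eqP => // _.
  have [i [j [ij cij]]] : exists i j, i != j /\ c i = c j.
    apply: contrapT => h; apply: c_ninj => i j cij; apply: contrapT => /eqP ij.
    by apply: h; exists i, j.
  rewrite -det_tr (determinant_alternate ij) // => t; by rewrite !mxE cij.
pose J := [set c t | t : 'I_a]%SET.
have cardJ : #|J| = a by rewrite card_imset // card_ord.
pose d t : 'I_N := enum_val (cast_ord (esym cardJ) t).
have dJ t : d t \in J by apply: enum_valP.
have d_inj : injective d by move=> t t' /enum_val_inj/cast_ord_inj.
have /choice[s sP] : forall t, exists u, d u = c t.
  move=> t; have ctJ : c t \in J by apply: imset_f.
  exists (cast_ord cardJ (enum_rank_in ctJ (c t))).
  by rewrite /d cast_ordK enum_rankK_in.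
have s_inj : injective s by move=> t t' st; apply: c_inj; rewrite -!sP st.
exists ((-1) ^+ perm s_inj), J => b; case: eqP => [sb|/eqP sb]; last first.
  rewrite /minor ifN ?mulr0 //; apply: contraNneq sb => <-; exact/eqP.
rewrite (minor_enum (esym cardJ) sb).
have -> : colsub c (coord_mx a b) = col_perm (perm s_inj) (colsub d (coord_mx a b)).
  by apply/matrixP => r t; rewrite !mxE permE sP.
by rewrite col_permE det_mulmx det_perm mulrC odd_permV.
Qed.

Definition replace_col a (c : 'I_a -> 'I_N) t i : 'I_a -> 'I_N :=
  fun u => if u == t then i else c u.

(** The entries are signed Pluecker coordinates of the span of [b]; by Laplace
    expansion along the replaced column, the rows are vectors of that span. *)
Definition pluecker_mx a b (c : 'I_a -> 'I_N) : 'M[k]_(a, N) :=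
  \matrix_(t < a, i < N)
    if size b == a then \det (colsub (replace_col c t i) (coord_mx a b)) else 0.

Lemma pluecker_mxE a b (c : 'I_a -> 'I_N) : size b = a ->
  pluecker_mx b c = \adj (colsub c (coord_mx a b)) *m coord_mx a b.
Proof.
move=> sb; apply/matrixP => t i; rewrite !mxE sb eqxx (expand_det_col _ t).
apply: eq_bigr => r _; rewrite !mxE /replace_col eqxx mulrC; congr (_ * _).
rewrite /cofactor; congr (_ * \det _); apply/matrixP => r' t'.
by rewrite !mxE eq_sym (negPf (neq_lift _ _)).
Qed.

Lemma pluecker_mx_sub a b (c : 'I_a -> 'I_N) a' :
  (a' = size b) -> (pluecker_mx b c <= coord_mx a' b)%MS.
Proof.
move=> ->; have [sb|sb] := eqVneq (size b) a; first by rewrite pluecker_mxE // sb submxMl.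
rewrite (_ : pluecker_mx b c = 0) ?sub0mx //.
by apply/matrixP => t i; rewrite !mxE (negPf sb).
Qed.

Lemma pluecker_mx_eq a b : size b = a -> free b ->
  exists c : 'I_a -> 'I_N, (pluecker_mx b c == coord_mx a b)%MS.
Proof.
move=> sb fb; have full : row_full (coord_mx a b)^T.
  by rewrite /row_full mxrank_tr -sb -dim_span_coord_mx.
exists (fullrankfun full); rewrite pluecker_mxE // submxMl /=.
set B := coord_mx a b; set c := fullrankfun full.
have uB : colsub c B \in unitmx.
  by rewrite -unitmx_tr trmx_mxsub; apply: fullrowsub_unit.
apply/submxP; exists ((\det (colsub c B))^-1 *: colsub c B).
rewrite -scalemxAl mulmxA mul_mx_adj mul_scalar_mx scalerA mulVf ?scale1r //.
by rewrite -unitfE -unitmxE.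
Qed.

Definition stacked_mx a a' c c' (b b' : seq V) : 'M[k]_(a + a', N) :=
  col_mx (@pluecker_mx a b c) (@pluecker_mx a' b' c').

Lemma mxsub_det_rank m r (f : 'I_r -> 'I_m) (g : 'I_r -> 'I_N) (A : 'M[k]_(m, N)) :
  \det (mxsub f g A) != 0 -> (r <= \rank A)%N.
Proof.
rewrite -unitfE -unitmxE => /mxrank_unit {1}<-.
have -> : mxsub f g A = colsub g (rowsub f A) by rewrite -mxsub_comp.
rewrite -mxrank_tr trmx_mxsub (leq_trans (mxrankS (rowsub_sub _ _))) //.
by rewrite mxrank_tr mxrankS // rowsub_sub.
Qed.

Lemma rank_mxsub_det m (A : 'M[k]_(m, N)) :
  exists (f : 'I_(\rank A) -> 'I_m) g, \det (mxsub f g A) != 0.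
Proof.
have full : row_full (rowsub (maxrankfun A) A)^T.
  by rewrite /row_full mxrank_tr eq_maxrowsub.
exists (maxrankfun A), (fullrankfun full).
rewrite -unitfE -unitmxE -unitmx_tr.
have := fullrowsub_unit full; set g := fullrankfun _.
by congr (_ \in unitmx); apply/matrixP => i j; rewrite !mxE.
Qed.

Lemma dim_addv_geP (U W : {vspace V}) b b' s :
    basis_of U b -> basis_of W b' ->
  reflect (exists a a' (c : 'I_a -> 'I_N) (c' : 'I_a' -> 'I_N) r
      (f : 'I_r -> 'I_(a + a')) g,
      (s <= r)%N /\ \det (mxsub f g (stacked_mx c c' b b')) != 0)
    (s <= \dim (U + W))%N.
Proof.
move=> bU bW.
have -> : \dim (U + W) = \rank (coord_mx (size b) b + coord_mx (size b') b')%MS.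
  rewrite -(span_basis bU) -(span_basis bW) -span_cat dim_span_coord_mx.
  by rewrite size_cat coord_mx_cat // addsmxE.
apply: (iffP idP) => [le_s|[a [a' [c [c' [r [f [g [le_s det_neq0]]]]]]]]].
  have [c cP] := pluecker_mx_eq (erefl (size b)) (basis_free bU).
  have [c' cP'] := pluecker_mx_eq (erefl (size b')) (basis_free bW).
  have [f [g fgP]] := rank_mxsub_det (stacked_mx c c' b b').
  exists (size b), (size b'), c, c', _, f, g; split=> //.
  rewrite (leq_trans le_s) // -addsmxE.
  by rewrite mxrankS // addsmxS // ?(eqmxP cP) ?(eqmxP cP').
rewrite (leq_trans le_s) // (leq_trans (mxsub_det_rank det_neq0)) //.
by rewrite -addsmxE mxrankS // addsmxS // pluecker_mx_sub.
Qed.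

Definition coord_fun (f : (coord_index V -> k) -> k) : Prop :=
  exists p, forall v, f v = mpoly.meval (fun j : 'I_#|coord_index V| => v (enum_val j)) p.

Lemma coord_fun_subalgebra : fun_subalgebra coord_fun.
Proof.
split=> [c|f g [p fp] [q gq]|f g [p fp] [q gq]].
- by exists (mpoly.mpolyC _ c) => v; rewrite mpoly.mevalC.
- by exists (p + q) => v; rewrite mpoly.mevalD fp gq.
- by exists (p * q) => v; rewrite mpoly.mevalM fp gq.
Qed.

Lemma coord_fun_coord j : coord_fun (fun v => v j).
Proof.
by exists (mpoly.mpolyX _ (mpoly.mnm1 (enum_rank j))) => v; rewrite mpoly.mevalXU enum_rankK.
Qed.

Lemma stacked_mx_coord_fun a a' (c : 'I_a -> 'I_N) (c' : 'I_a' -> 'I_N) i j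
    (t : 'I_(a + a')) (u : 'I_N) :
  exists2 h, coord_fun h &
    forall b1 b2 : 'I_N.+1 -> seq V, h (pluecker b1 b2) = stacked_mx c c' (b1 i) (b2 j) t u.
Proof.
have [Acst _ AM] := coord_fun_subalgebra.
case: (splitP t) => t' tt'.
  have [eps [J epsJ]] := det_colsub_minor (replace_col c t' u).
  exists (fun v => eps * v (inl i, J)).
    by apply: AM; [exact: Acst | exact: coord_fun_coord].
  have -> : t = lshift a' t' by apply: val_inj.
  by move=> b1 b2; rewrite epsJ /stacked_mx col_mxEu mxE.
have [eps [J epsJ]] := det_colsub_minor (replace_col c' t' u).
exists (fun v => eps * v (inr j, J)).
  by apply: AM; [exact: Acst | exact: coord_fun_coord].
have -> : t = rshift a t' by apply: val_inj.
by move=> b1 b2; rewrite epsJ /stacked_mx col_mxEd mxE.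
Qed.

Lemma zariski_open_dim_addv (i j : 'I_N.+1) s :
  zariski_open [set x : flag * flag | (s <= \dim (step x.1 i + step x.2 j))%N]%classic.
Proof.
exists [set p | exists a a' (c : 'I_a -> 'I_N) (c' : 'I_a' -> 'I_N) r
  (f : 'I_r -> 'I_(a + a')) g, (s <= r)%N /\
  forall b1 b2 : 'I_N.+1 -> seq V,
    mpoly.meval (fun j : 'I_#|coord_index V| => pluecker b1 b2 (enum_val j)) p =
    \det (mxsub f g (stacked_mx c c' (b1 i) (b2 j)))]%classic.
move=> x b1 b2 b1P b2P; split=> [nU p [a [a' [c [c' [r [f [g [le_s ->]]]]]]]]|h].
  apply: contrapT => /eqP det_neq0; apply: nU.
  by apply/(dim_addv_geP _ (b1P i) (b2P j)); exists a, a', c, c', r, f, g.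
move=> /(dim_addv_geP _ (b1P i) (b2P j))[a [a' [c [c' [r [f [g [le_s]]]]]]]].
have /choice[h' h'P] : forall tu : 'I_r * 'I_r, exists h', coord_fun h' /\
    forall b1 b2 : 'I_N.+1 -> seq V,
      h' (pluecker b1 b2) = stacked_mx c c' (b1 i) (b2 j) (f tu.1) (g tu.2).
  by move=> tu; have [H] := stacked_mx_coord_fun c c' i j (f tu.1) (g tu.2); exists H.
have [p pP] : coord_fun (fun v => \det (\matrix_(t, u) h' (t, u) v)).
  apply: (fun_subalgebra_det coord_fun_subalgebra) => t u.
  have [[p hp] _] := h'P (t, u).
  by exists p => v; rewrite mxE hp.
have pdet (b1' b2' : 'I_N.+1 -> seq V) :
    mpoly.meval (fun j : 'I_#|coord_index V| => pluecker b1' b2' (enum_val j)) p =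
    \det (mxsub f g (stacked_mx c c' (b1' i) (b2' j))).
  rewrite -pP; congr (\det _); apply/matrixP => t u; rewrite mxE [RHS]mxE.
  by have [_ ->] := h'P (t, u).
by rewrite -pdet h ?eqxx //; exists a, a', c, c', r, f, g.
Qed.

End Pluecker.

(** * Irreducibility of the varieties of chains of flags *)

Section Curves.
Import VectorInternalTheory passmx.
Variables (k : closedFieldType) (V : vectType k).
Local Notation N := (\dim {: V}).
Local Notation flag := (flag V).
Local Notation orbit := (Defs.orbit V).
Local Notation e := (vbasis {: V}).

Definition act (g : 'End(V)) (f : flag) : flag :=
  insubd f [ffun i => (g @: step f i)%VS].

Lemma step_act g f i : lker g == 0%VS -> step (act g f) i = (g @: step f i)%VS.
Proof.
move=> g0; rewrite /step /act val_insubd ifT ?ffunE //.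
have /and3P[/eqP f0 /eqP f1 /'forall_'forall_implyP fle] := valP f.
apply/and3P; split; rewrite ?ffunE /step ?f0 ?f1 ?limg0 //.
  by rewrite eqEdim subvf limg_dim_eq ?leqnn // (eqP g0) capv0.
by apply/'forall_'forall_implyP => i' j' /fle le; rewrite !ffunE limgS.
Qed.

Lemma translate_act g f : lker g == 0%VS -> translate g f (act g f).
Proof. by move=> g0 i; apply: step_act. Qed.

Lemma translate_actE g f f' : lker g == 0%VS -> translate g f f' -> act g f = f'.
Proof. by move=> g0 h; apply: flagP => i; rewrite h step_act. Qed.

Lemma lker0_id : lker (\1%VF : 'End(V)) == 0%VS.
Proof. by apply/lker0P => u v; rewrite !id_lfunE. Qed.

Lemma act_id f : act \1%VF f = f.
Proof. by apply: translate_actE lker0_id (translate_refl f). Qed.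

Lemma orbit_act (o : orbit) g f f' : lker g == 0%VS ->
  val o (f, f') -> val o (act g f, act g f').
Proof.
move=> g0 of'; rewrite (Defs.orbitE of'); exists g.
by split; rewrite //=; apply: translate_act.
Qed.

Definition poly_curve (h : k -> 'End(V)) : Prop :=
  forall v i, poly_fun (fun t => coord e i (h t v)).

Lemma poly_curve_comp h h' :
  poly_curve h -> poly_curve h' -> poly_curve (fun t => (h t \o h' t)%VF).
Proof.
move=> hP hP' v i; have subA := poly_fun_subalgebra k; have [_ _ AM] := subA.
have := fun_subalgebra_sum subA (index_enum 'I_N) xpredT
  (fun j => AM _ _ (hP' v j) (hP e`_j i)).
move=> [p pP]; exists p => t; rewrite -pP comp_lfunE.
rewrite {1}[h' t v](coord_vbasis (memvf _)) !linear_sum /=.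
by apply: eq_bigr => j _; rewrite !linearZ.
Qed.

Lemma poly_curve_line g0 g1 : poly_curve (fun t => g0 + t *: (g1 - g0)).
Proof.
move=> v i; exists ((coord e i (g0 v))%:P + (coord e i ((g1 - g0) v))%:P * 'X) => t.
rewrite add_lfunE scale_lfunE linearD linearZ /= hornerD hornerM !hornerC hornerX.
by rewrite mulrC.
Qed.

Lemma lker0_unitmx (g : 'End(V)) : (lker g == 0%VS) = (mxof e e g \in unitmx).
Proof. by rewrite (lker_ker (vbasisP _)) (vsof_eq0 (vbasisP _)) kermx_eq0 row_free_unit. Qed.

Lemma poly_curve_lker0 h t0 : poly_curve h -> lker (h t0) == 0%VS ->
  generically (fun t => lker (h t) == 0%VS).
Proof.
move=> hP; rewrite lker0_unitmx unitmxE unitfE => h0.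
have dP : poly_fun (fun t => \det (mxof e e (h t))).
  apply: (fun_subalgebra_det (poly_fun_subalgebra k)) => i j.
  have [p pP] := hP (vecof e (delta_mx 0 i)) j.
  by exists p => t; rewrite -pP !mxE.
apply: generically_sub (generically_neq0 dP h0) => t.
by rewrite lker0_unitmx unitmxE unitfE.
Qed.

Lemma minor_poly_fun h (b : seq V) J :
  poly_curve h -> poly_fun (fun t => minor (map (h t) b) J).
Proof.
move=> hP; have [Jb|Jb] := eqVneq #|J| (size b); last first.
  by exists 0 => t; rewrite horner0 /minor size_map ifN.
have [p pP] : poly_fun (fun t =>
    \det (\matrix_(r < #|J|, c < #|J|) coord e (enum_val c) (h t b`_r))).
  apply: (fun_subalgebra_det (poly_fun_subalgebra k)) => r c.
  have [p pP] := hP b`_r (enum_val c).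
  by exists p => t; rewrite -pP mxE.
exists p => t; rewrite -pP /minor size_map ifT; last exact/eqP.
by congr (\det _); apply/matrixP => r c; rewrite !mxE (nth_map 0) // -Jb.
Qed.

(** In bases that move with the flags the Pluecker coordinates are polynomials
    in the time, so an equation of the complement of [U] that does not vanish at
    [t0] vanishes at finitely many times only. *)
Lemma poly_curve_open (U : set (flag * flag)) h h' t0 f f' :
    zariski_open U -> poly_curve h -> poly_curve h' ->
    lker (h t0) == 0%VS -> lker (h' t0) == 0%VS ->
    U (act (h t0) f, act (h' t0) f') ->
  generically (fun t => U (act (h t) f, act (h' t) f')).
Proof.
move=> [P UP] hP hP' h0 h0' U0.
pose b t i : seq V := map (h t) (vbasis (step f i)).
pose b' t i : seq V := map (h' t) (vbasis (step f' i)).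
have bP t i : lker (h t) == 0%VS -> basis_of (step (act (h t) f) i) (b t i).
  by move=> ht; rewrite step_act // limg_basis_of ?vbasisP // (eqP ht) capv0.
have bP' t i : lker (h' t) == 0%VS -> basis_of (step (act (h' t) f') i) (b' t i).
  by move=> ht; rewrite step_act // limg_basis_of ?vbasisP // (eqP ht) capv0.
pose ev t p := mpoly.meval
  (fun j : 'I_#|coord_index V| => pluecker (b t) (b' t) (enum_val j)) p.
have UPt t : lker (h t) == 0%VS -> lker (h' t) == 0%VS ->
    (~ U (act (h t) f, act (h' t) f') <-> forall p, P p -> ev t p = 0).
  move=> ht ht'; exact: (UP (act (h t) f, act (h' t) f') (b t) (b' t)
    (fun i => bP t i ht) (fun i => bP' t i ht')).
have [p Pp p0] : exists2 p, P p & ev t0 p != 0.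
  apply: contrapT => np; have [_ nU] := UPt t0 h0 h0'; apply: nU U0 => p Pp.
  by apply: contrapT => /eqP p0; apply: np; exists p.
have evP : poly_fun (ev^~ p).
  apply: (fun_subalgebra_meval (poly_fun_subalgebra k) p) => j.
  by case: (enum_val j) => -[i|i] J; apply: minor_poly_fun.
apply: generically_sub (generically_and (generically_neq0 evP p0)
  (generically_and (poly_curve_lker0 hP h0) (poly_curve_lker0 hP' h0'))) => t.
move=> [pt [ht ht']]; apply: contrapT => nU; move/eqP: pt; apply.
by have [ev0 _] := UPt t ht ht'; apply: ev0.
Qed.

Definition chain (m : nat) (o : nat -> orbit) (x : nat -> flag) : Prop :=
  forall i, (i < m)%N -> val (o i) (x i, x i.+1).

Definition stabilizes (s : 'End(V)) (f : flag) : Prop :=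
  forall i, (s @: step f i <= step f i)%VS.

Lemma stabilizes_act s f : lker s == 0%VS -> stabilizes s f -> act s f = f.
Proof.
move=> s0 sf; apply: flagP => i; rewrite step_act //; apply/eqP.
by rewrite eqEdim sf limg_dim_eq ?leqnn // (eqP s0) capv0.
Qed.

Lemma stabilizes_line s f t : stabilizes s f -> stabilizes (\1 + t *: (s - \1))%VF f.
Proof.
move=> sf i; apply/subvP => _ /memv_imgP[v vf ->].
rewrite add_lfunE scale_lfunE add_lfunE opp_lfunE id_lfunE.
by rewrite memvD // memvZ // memvB //; apply/(subvP (sf i))/memv_img.
Qed.

Lemma act_comp g g' f : lker g == 0%VS -> lker g' == 0%VS ->
  act (g \o g')%VF f = act g (act g' f).
Proof.
move=> g0 g0'; apply: flagP => i.
by rewrite (step_act _ _ (lker0_comp g0' g0)) limg_comp !step_act.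
Qed.

(** The [i]-th flag of the second chain is obtained from that of the first one by
    moving it with [g * s_1 * ... * s_(i-1)], where [s_j] stabilizes the [j]-th
    flag. The stabilizer of a flag is open in a linear space of endomorphisms,
    so [g] and the [s_j] can be joined to the identity by segments. *)
Lemma chain_curve m o x y : chain m.+1 o x -> chain m.+1 o y ->
  exists h : nat -> k -> 'End(V),
  [/\ forall i, (i <= m.+1)%N -> poly_curve (h i),
      forall i, (i <= m.+1)%N -> h i 0 = \1%VF,
      forall i, (i <= m.+1)%N -> lker (h i 1) == 0%VS /\ act (h i 1) (x i) = y i &
      generically (fun t => chain m.+1 o (fun i => act (h i t) (x i)))].
Proof.
move=> cx cy.
have [g gP] : exists g : nat -> 'End(V), forall i, (i < m.+1)%N ->
    [/\ lker (g i) == 0%VS, act (g i) (x i) = y i & act (g i) (x i.+1) = y i.+1].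
  have /choice[g gP] : forall i, exists g, (i < m.+1)%N ->
      [/\ lker g == 0%VS, act g (x i) = y i & act g (x i.+1) = y i.+1].
    move=> i; case: (ltnP i m.+1) => [im|]; last by exists 0.
    have := cy i im; rewrite (Defs.orbitE (cx i im)) => -[g [g0 gx gy]].
    by exists g => _; split=> //; apply: translate_actE.
  by exists g.
(* [s i] stabilizes [x i], as [g i.-1] and [g i] both send it to [y i]. *)
pose s i := if i is j.+1 then ((g j)^-1 \o g i)%VF else \1%VF.
pose S i t : 'End(V) := (\1 + t *: (s i - \1))%VF.
pose h := fix h i t := if i is j.+1 then (h j t \o S j t)%VF
                       else (\1 + t *: (g 0%N - \1))%VF.
have s0 i : (i < m.+1)%N -> lker (s i) == 0%VS.
  case: i => [|i] im; first exact: lker0_id.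
  by have [gi _ _] := gP i (ltnW im); have [gi' _ _] := gP i.+1 im;
    apply: lker0_comp gi' (lker0_inv gi).
have s_stab i : (i < m.+1)%N -> stabilizes (s i) (x i).
  case: i => [|i] im j /=; first by rewrite lim1g.
  have [gi0 gx gx'] := gP i (ltnW im); have [gi0' gy gy'] := gP i.+1 im.
  have gstep : (g i.+1 @: step (x i.+1) j = g i @: step (x i.+1) j)%VS.
    by rewrite -(step_act _ _ gi0') -(step_act _ _ gi0) gy gx'.
  by rewrite limg_comp gstep -limg_comp lker0_compVf // lim1g.
have S1 i : S i 1 = s i by rewrite /S scale1r addrC subrK.
have hS i : (i <= m)%N -> h i.+1 1 = g i.
  elim: i => [|i IHi] im.
    by rewrite /= S1 scale1r addrC subrK comp_lfun1r.
  have [gi0 _ _] := gP i (ltnW im).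
  rewrite [LHS](_ : _ = (h i.+1 1 \o S i.+1 1)%VF) // IHi ?(ltnW im) // S1.
  by rewrite comp_lfunA lker0_compfV // comp_lfun1l.
exists h; split.
- by elim=> [|i IHi] im; [|apply: poly_curve_comp; first exact: IHi (ltnW im)];
    apply: poly_curve_line.
- elim=> [|i IHi] im; first by rewrite /= scale0r addr0.
  by rewrite /= IHi ?(ltnW im) // /S scale0r addr0 comp_lfun1l.
- case=> [|i] im; last by rewrite hS //; case: (gP i im).
  by rewrite /= scale1r addrC subrK; case: (gP 0%N).
have genS i : (i < m.+1)%N -> generically (fun t => lker (S i t) == 0%VS).
  move=> im; apply: (@poly_curve_lker0 _ 1); first exact: poly_curve_line.
  by rewrite /S scale1r addrC subrK s0.
have genh i : (i <= m.+1)%N -> generically (fun t => lker (h i t) == 0%VS).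
  elim: i => [|i IHi] im.
    apply: (@poly_curve_lker0 _ 1); first exact: poly_curve_line.
    by rewrite /= scale1r addrC subrK; case: (gP 0%N).
  apply: generically_sub (generically_and (IHi (ltnW im)) (genS _ im)) => t [? ?].
  exact: lker0_comp.
suff: forall l, (l <= m.+1)%N ->
    generically (fun t => chain l o (fun i => act (h i t) (x i))) by apply.
elim=> [|l IHl] lm; first by exists 1; [exact: oner_neq0 | move=> t _ i].
apply: generically_sub (generically_and (IHl (ltnW lm))
  (generically_and (genS _ lm) (genh _ (ltnW lm)))) => t [IH [S0 h0]] i.
rewrite ltnS leq_eqVlt => /predU1P[->|/IH //].
have := orbit_act (lker0_comp S0 h0) (cx l lm).
by rewrite act_comp // [act (S l t) _]stabilizes_act //; apply/stabilizes_line/s_stab.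
Qed.

(** On the curve of [chain_curve] between the two chains, each of the conditions
    holds at one end and therefore generically. *)
Lemma chain_irreducible m o x y (U U' : set (flag * flag)) i j i' j' :
    chain m.+1 o x -> chain m.+1 o y -> zariski_open U -> zariski_open U' ->
    (i <= m.+1)%N -> (j <= m.+1)%N -> (i' <= m.+1)%N -> (j' <= m.+1)%N ->
    U (x i, x j) -> U' (y i', y j') ->
  exists z, [/\ chain m.+1 o z, U (z i, z j) & U' (z i', z j')].
Proof.
move=> cx cy oU oU' im jm im' jm' Ux Uy.
have [h [hP h0 h1 genc]] := chain_curve cx cy.
have genU : generically (fun t => U (act (h i t) (x i), act (h j t) (x j))).
  by apply: (@poly_curve_open _ _ _ 0); rewrite ?h0 ?act_id ?lker0_id //; apply: hP.
have genU' : generically (fun t => U' (act (h i' t) (x i'), act (h j' t) (x j'))).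
  apply: (@poly_curve_open _ _ _ 1); rewrite ?(h1 _ _).2 //; try exact: hP.
    by case: (h1 i' im').
  by case: (h1 j' jm').
have [t [ct [Ut Ut']]] := generically_ex (generically_and genc (generically_and genU genU')).
by exists (fun i => act (h i t) (x i)).
Qed.

End Curves.

(** * Relative position determines the orbit of a pair of complete flags *)

Section RelativePosition.
Variables (k : closedFieldType) (V : vectType k).
Local Notation N := (\dim {: V}).
Local Notation flag := (flag V).
Local Notation orbit := (Defs.orbit V).
Implicit Types f g : flag.

(** Steps indexed by all natural numbers, the steps after the last one being the
    whole space, so that arithmetic on indices needs no bounds. *)
Definition st f (a : nat) : {vspace V} := step f (inord (minn a N)).

Lemma stE f (i : 'I_N.+1) : st f i = step f i.
Proof. by rewrite /st (minn_idPl (leq_ord i)) inord_val. Qed.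

Lemma st_le f a b : (a <= b)%N -> (st f a <= st f b)%VS.
Proof.
move=> ab; apply: step_le; rewrite !inordK ?ltnS ?geq_minr //.
by rewrite leq_min geq_minr andbT (leq_trans (geq_minl _ _)).
Qed.

Lemma st0 f : st f 0 = 0%VS.
Proof. by rewrite -[X in st _ X]/(nat_of_ord (@ord0 N)) stE step0. Qed.

Lemma stN f a : (N <= a)%N -> st f a = {: V}%VS.
Proof.
move=> Na; rewrite /st (minn_idPr Na) -[X in inord X]/(nat_of_ord (@ord_max N)).
by rewrite inord_val; have /and3P[_ /eqP] := valP f.
Qed.

Lemma dim_st f a : complete f -> (a <= N)%N -> \dim (st f a) = a.
Proof. by move=> cf aN; rewrite /st (minn_idPl aN) cf inordK. Qed.

Lemma completeE f : (forall a, (a <= N)%N -> \dim (st f a) = a) -> complete f.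
Proof. by move=> h i; rewrite -stE h // leq_ord. Qed.

Lemma eq_flag f g : (forall a, (a <= N)%N -> st f a = st g a) -> f = g.
Proof. by move=> h; apply: flagP => i; rewrite -!stE h // leq_ord. Qed.

Lemma flag_of_steps (F : nat -> {vspace V}) :
    F 0 = 0%VS -> F N = {: V}%VS -> (forall a, (a < N)%N -> (F a <= F a.+1)%VS) ->
  exists f, forall a, (a <= N)%N -> st f a = F a.
Proof.
move=> F0 FN Fle.
have Fmono a b : (a <= b)%N -> (b <= N)%N -> (F a <= F b)%VS.
  move=> ab; rewrite -(subnKC ab); elim: (b - a)%N => [|d IHd]; first by rewrite addn0.
  by rewrite addnS => dN; apply: subv_trans (IHd (ltnW dN)) (Fle _ dN).
have flagF : is_flag [ffun i : 'I_N.+1 => F i].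
  apply/and3P; split; rewrite ?ffunE ?F0 ?FN //.
  by apply/'forall_'forall_implyP => i j ij; rewrite !ffunE Fmono // leq_ord.
exists (Sub _ flagF) => a aN.
by rewrite /st (minn_idPl aN) /step /= ffunE inordK.
Qed.

Lemma dim_addv_line (U : {vspace V}) v : v \notin U -> \dim (U + <[v]>) = (\dim U).+1.
Proof.
move=> vU; apply/eqP; rewrite eqn_leq; apply/andP; split.
  have := (dimv_add_leqif U <[v]>).1; rewrite dim_vline => /leq_trans; apply.
  by rewrite -addn1 leq_add2l leq_b1.
rewrite ltnNge; apply: contraNN vU => le.
have := dimv_leqif_sup (addvSl U <[v]>%VS).
case=> _; rewrite eqn_leq le dimvS ?addvSl //= subv_add subvv /= => /esym.
by rewrite -memvE.
Qed.

Definition capd f g a b := \dim (st f a :&: st g b).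

Section Adapted.
Variables (f f' : flag).
Hypotheses (cf : complete f) (cf' : complete f').
Local Notation jump i b := (capd f f' i.+1 b != capd f f' i b).

Lemma jumpE i b : jump i b = ~~ (st f i.+1 :&: st f' b <= st f i)%VS.
Proof.
have sub : (st f i :&: st f' b <= st f i.+1 :&: st f' b)%VS by rewrite capvS ?st_le.
congr (~~ _); rewrite eq_sym /capd (dimv_leqif_eq sub).2 eqEsubv sub /=.
by rewrite subv_cap capvSr andbT.
Qed.

Lemma jumpN i : (i < N)%N -> jump i N.
Proof.
by move=> iN; rewrite /capd !(stN _ (leqnn N)) !capvf !dim_st ?(ltnW iN) // neq_ltn ltnSn orbT.
Qed.

Lemma capd_jump i b : (i < N)%N -> (capd f f' i.+1 b <= capd f f' i b + jump i b)%N.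
Proof.
move=> iN; case: (boolP (jump i b)) => [_|/negbNE/eqP->]; last by rewrite leq_addr.
have := dimv_sum_cap (st f i.+1 :&: st f' b) (st f i).
rewrite [X in (_ + \dim X)%N]capvC capvA (capv_idPl (st_le f (leqnSn i))).
rewrite -/(capd f f' i b) -/(capd f f' i.+1 b) (dim_st cf (ltnW iN)) => E.
have : (\dim (st f i.+1 :&: st f' b + st f i) <= i.+1)%N.
  by rewrite -{2}(dim_st cf iN) dimvS // subv_add capvSl st_le.
by rewrite -(leq_add2r (capd f f' i b)) E addSnnS addnC leq_add2l addn1.
Qed.

(** The vector [v i] is taken in the [i.+1]-st step of [f], outside the previous
    one, and in the first step of [f'] where this is possible. The vectors that
    lie in the [b]-th step of [f'] span it by counting: the dimension of its
    intersection with the [i]-th step of [f] grows by at most one with [i], and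
    each growth contributes a vector. *)
Lemma adapted_basis : exists v : nat -> V,
  (forall j, (j <= N)%N -> st f j = <<map v (iota 0 j)>>%VS) /\
  (forall b, (b <= N)%N -> st f' b = <<[seq v i | i <- iota 0 N & jump i b]>>%VS).
Proof.
have /choice[v vP] : forall i, exists v, (i < N)%N -> [/\ v \in st f i.+1, v \notin st f i &
    forall b, jump i b -> v \in st f' b].
  move=> i; case: (ltnP i N) => [iN|]; last by exists 0.
  have ex : exists b, jump i b by exists N; apply: jumpN.
  case: (ex_minnP ex) => b; rewrite jumpE => /subvPn[v].
  rewrite memv_cap => /andP[v1 v2] v3 bmin; exists v => _; split=> // b' /bmin bb'.
  exact: subvP (st_le f' bb') _ v2.
have span_f j : (j <= N)%N -> st f j = <<map v (iota 0 j)>>%VS.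
  elim: j => [|j IHj] jN; first by rewrite st0 span_nil.
  have [v1 v2 _] := vP j jN.
  rewrite -addn1 iotaD map_cat span_cat -(IHj (ltnW jN)) span_seq1 addn1 add0n.
  apply/eqP; rewrite eq_sym eqEdim subv_add st_le // -memvE v1 /= (dim_st cf jN).
  by rewrite -{1}(dim_st cf (ltnW jN)) dim_addv_line.
exists v; split=> // b bN.
have vfree : free (map v (iota 0 N)).
  by rewrite /free -span_f // size_map size_iota dim_st.
set s := [seq v i | i <- _ & _].
have sfree : free s.
  have : perm_eq (s ++ [seq v i | i <- iota 0 N & ~~ (jump i b)]) (map v (iota 0 N)).
    by rewrite -map_cat perm_map // perm_filterC.
  by move/perm_free; rewrite vfree cat_free => /and3P[].
have /eqP dims := sfree.
apply/eqP; rewrite eq_sym eqEdim; apply/andP; split.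
  apply/span_subvP => _ /mapP[i + ->]; rewrite mem_filter mem_iota => /andP[ji /andP[_ iN]].
  by have [_ _] := vP i iN; apply.
rewrite dims dim_st // size_map size_filter.
suff: forall j, (j <= N)%N -> (capd f f' j b <= count (fun i => jump i b) (iota 0 j))%N.
  by move/(_ N (leqnn N)); rewrite /capd stN // capfv dim_st.
elim=> [|j IHj] jN; first by rewrite /capd st0 cap0v dimv0.
rewrite -addn1 iotaD count_cat add0n /= addn0 addn1.
by rewrite (leq_trans (capd_jump b jN)) // leq_add2r IHj // ltnW.
Qed.

End Adapted.

(** The jumps of the dimensions tell which vectors of an adapted basis span each
    step of the second flag, so the linear map between the adapted bases of the
    two pairs matches the steps. *)
Lemma same_capd_orbit f f' g g' :
    complete f -> complete f' -> complete g -> complete g' ->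
    (forall a b, (a <= N)%N -> (b <= N)%N -> capd f f' a b = capd g g' a b) ->
  gl_orbit (f, f') (g, g').
Proof.
move=> cf cf' cg cg' same.
have [v [vf vf']] := adapted_basis cf cf'; have [w [wg wg']] := adapted_basis cg cg'.
have vfree : free (map v (iota 0 N)).
  by rewrite /free -vf // size_map size_iota dim_st.
have [h0 h0P] := linear_of_free (map v (iota 0 N)) (map w (iota 0 N)).
pose h := linfun h0.
have hv i : (i < N)%N -> h (v i) = w i.
  move=> iN; have := h0P vfree _; rewrite !size_map -map_comp => /(_ erefl) /eq_in_map.
  by move/(_ i); rewrite mem_iota add0n iN => /(_ isT) <-; rewrite lfunE.
have hspan (r : seq nat) : {in r, forall i, (i < N)%N} ->
    (h @: <<map v r>> = <<map w r>>)%VS.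
  by move=> rN; rewrite limg_span -map_comp; congr span; apply/eq_in_map => i /rN /hv.
have hf a : (a <= N)%N -> (h @: st f a = st g a)%VS.
  move=> aN; rewrite vf // wg // hspan // => i; rewrite mem_iota => /andP[_ ia].
  exact: leq_trans ia aN.
have hf' b : (b <= N)%N -> (h @: st f' b = st g' b)%VS.
  move=> bN; rewrite vf' // wg' // hspan => [|i].
    congr <<map w _>>%VS; apply: eq_in_filter => i; rewrite mem_iota add0n => /andP[_ iN].
    by rewrite !same // ltnW.
  by rewrite mem_filter mem_iota => /andP[_ /andP[_ iN]].
exists h; split=> [|i|i]; rewrite /= -?stE ?hf ?hf' // ?leq_ord //.
have := limg_ker_dim h {: V}; rewrite capfv -[X in (_ @: X)%VS](stN f (leqnn N)).
rewrite hf // stN // => /eqP; rewrite -[X in _ == X]add0n eqn_add2r.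
by rewrite dimv_eq0.
Qed.

End RelativePosition.

(** * The monoid of orbits of pairs of complete flags *)

Section OrbitMonoid.
Variables (k : closedFieldType) (V : vectType k).
Local Notation N := (\dim {: V}).
Local Notation flag := (flag V).
Local Notation orbit := (Defs.orbit V).
Implicit Types (f : flag) (x y : flag * flag).

(** The pairs at least as generic as [x] for every rank condition; on pairs of
    complete flags this is the Bruhat order. *)
Definition near x : set (flag * flag) :=
  [set y | forall i j, (\dim (step x.1 i + step x.2 j) <=
                        \dim (step y.1 i + step y.2 j))%N]%classic.

Lemma near_refl x : near x x. Proof. by move=> i j. Qed.

Lemma near_trans x y z : near x y -> near y z -> near x z.
Proof. by move=> xy yz i j; apply: leq_trans (xy i j) (yz i j). Qed.

Lemma zariski_open_near x : zariski_open (near x).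
Proof.
have := @zariski_open_all _ _ _ (enum {: 'I_N.+1 * 'I_N.+1}) _
  (fun ij => zariski_open_dim_addv ij.1 ij.2 (\dim (step x.1 ij.1 + step x.2 ij.2))).
congr zariski_open; apply/seteqP; split=> y /=.
  by move/allP => h i j; have /asboolP := h (i, j) (mem_enum _ _).
by move=> h; apply/allP => -[i j] _; apply/asboolP; apply: h.
Qed.

Lemma gl_orbit_near x y : gl_orbit x y -> near x y.
Proof.
move=> [g [g0 h1 h2]] i j; rewrite h1 h2 -limgD limg_dim_eq //.
by rewrite (eqP g0) capv0.
Qed.

Lemma nearE x y : complete x.1 -> complete x.2 -> complete y.1 -> complete y.2 ->
  near x y <-> forall a b, (a <= N)%N -> (b <= N)%N ->
    (capd y.1 y.2 a b <= capd x.1 x.2 a b)%N.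
Proof.
move=> cx cx' cy cy'.
have E a b : (a <= N)%N -> (b <= N)%N ->
    (\dim (st x.1 a + st x.2 b) <= \dim (st y.1 a + st y.2 b))%N =
    (capd y.1 y.2 a b <= capd x.1 x.2 a b)%N.
  move=> aN bN; have := dimv_sum_cap (st x.1 a) (st x.2 b).
  have := dimv_sum_cap (st y.1 a) (st y.2 b).
  rewrite !dim_st // /capd => <- Exy.
  by rewrite -(leq_add2r (\dim (st x.1 a :&: st x.2 b))) Exy leq_add2l.
split=> [h a b aN bN|h i j]; last by rewrite -!stE E ?h ?leq_ord.
by rewrite -E // /st; apply: h.
Qed.

Lemma near_gl_orbit x y : complete x.1 -> complete x.2 -> complete y.1 -> complete y.2 ->
  near x y -> near y x -> gl_orbit x y.
Proof.
move=> cx cx' cy cy' /(nearE cx cx' cy cy') xy /(nearE cy cy' cx cx') yx.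
rewrite [x]surjective_pairing [y]surjective_pairing.
by apply: same_capd_orbit => // a b aN bN; apply/eqP; rewrite eqn_leq xy ?yx.
Qed.

Definition generic (S : set (flag * flag)) x : Prop := S x /\ forall y, S y -> near y x.

(** A chain that maximizes the sum of the dimensions is generic: by
    irreducibility some chain is at least as generic as it and as any given one,
    and by maximality it has the same dimensions. *)
Lemma chain_generic m (o : nat -> orbit) (x : nat -> flag) : chain m.+1 o x ->
  exists z, chain m.+1 o z /\
    forall y : nat -> flag, chain m.+1 o y -> near (y 0, y m.+1) (z 0, z m.+1).
Proof.
pose weight (z : nat -> flag) :=
  (\sum_i \sum_j \dim (step (z 0%N) i + step (z m.+1) j))%N.
move=> cx; pose P w := `[< exists2 z, chain m.+1 o z & weight z = w >].
have exP : exists w, P w by exists (weight x); apply/asboolP; exists x.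
have boundP w : P w -> (w <= \sum_(i < N.+1) \sum_(j < N.+1) N)%N.
  by move=> /asboolP[z _ <-]; do 2!apply: leq_sum => ? _; apply: dimvS (subvf _).
case: (ex_maxnP exP boundP) => w /asboolP[z cz zw] wmax; exists z; split=> // y cy.
have [u [cu zu yu]] := chain_irreducible cz cy (zariski_open_near _) (zariski_open_near _)
  (leq0n _) (leqnn _) (leq0n _) (leqnn _)
  (@near_refl (z 0%N, z m.+1)) (@near_refl (y 0%N, y m.+1)).
suff uz : near (u 0%N, u m.+1) (z 0%N, z m.+1) by apply: near_trans yu uz.
have le : (weight u <= weight z)%N by rewrite zw wmax //; apply/asboolP; exists u.
move=> i j; rewrite leqNgt; apply/negP => lt; move: le; apply/negP; rewrite -ltnNge.
rewrite /weight (bigD1 i) //= (bigD1 j) //= [ltnRHS](bigD1 i) //= [in ltnRHS](bigD1 j) //=.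
rewrite -!addnA -addSn leq_add // ?leq_add //.
  by apply: leq_sum => j' _; apply: zu.
by apply: leq_sum => i' _; apply: leq_sum => j' _; apply: zu.
Qed.

Lemma complete_right (e : orbit) f : complete_pairs e -> complete f ->
  exists f', val e (f, f').
Proof.
move=> ce cf; have [x ex] := orbit_inhabited e; have [c1 c2] := ce x ex.
have [g g0 tr] := complete_transitive cf; have [h h0 tr'] := complete_transitive c1.
pose u := (g \o h^-1)%VF; have u0 : lker u == 0%VS := lker0_comp (lker0_inv h0) g0.
exists (act u x.2); rewrite (Defs.orbitE ex); exists u; split=> //=.
  by apply: translate_comp tr; apply: translate_inv.
exact: translate_act.
Qed.

Lemma complete_left (e : orbit) f : complete_pairs e -> complete f ->
  exists f', val e (f', f).
Proof.
move=> ce cf; have [x ex] := orbit_inhabited e; have [c1 c2] := ce x ex.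
have [g g0 tr] := complete_transitive cf; have [h h0 tr'] := complete_transitive c2.
pose u := (g \o h^-1)%VF; have u0 : lker u == 0%VS := lker0_comp (lker0_inv h0) g0.
exists (act u x.1); rewrite (Defs.orbitE ex); exists u; split=> //=.
  exact: translate_act.
by apply: translate_comp tr; apply: translate_inv.
Qed.

Lemma composites_act (e e' : orbit) x y : gl_orbit x y ->
  composites e e' x -> composites e e' y.
Proof.
move=> [g [g0 h1 h2]] [f [ef ef']]; exists (act g f).
by rewrite -(translate_actE g0 h1) -(translate_actE g0 h2); split; apply: orbit_act.
Qed.

Definition open_orbit (e e' : orbit) : orbit := xget e (open_orbits e e').

(** The orbit of [x] is cut out by the open condition [near x], and any other
    open orbit would meet it by irreducibility. *)
Lemma open_orbit_generic (e e' : orbit) x : complete_pairs e -> complete_pairs e' ->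
  generic (composites e e') x ->
  open_orbits e e' (open_orbit e e') /\ val (open_orbit e e') x.
Proof.
move=> ce ce' [Cx gx].
have comp y : composites e e' y -> complete y.1 /\ complete y.2.
  by move=> [f [/ce[/= c1 _] /ce'[/= _ c2]]].
have [cx cx'] := comp x Cx.
have oo : open_orbits e e' (orbit_of x).
  split=> [y /= xy|]; first exact: composites_act xy Cx.
  exists (near x); first exact: zariski_open_near.
  apply/seteqP; split=> [y /= xy|y [Cy xy]].
    by split; [exact: composites_act xy Cx | exact: gl_orbit_near].
  by have [cy cy'] := comp y Cy; apply: near_gl_orbit (gx y Cy).
suff -> : open_orbit e e' = orbit_of x by split=> //; apply: gl_orbit_refl.
have [so [U oU oE]] := xgetPex e (ex_intro _ _ oo).
have [y oy] := orbit_inhabited (open_orbit e e').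
have [[f [ef ef']] Uy] : (composites e e' `&` U)%classic y by rewrite -oE.
case: Cx => f' [e_f e_f'].
pose o i := if i is 0 then e else e'.
pose cx0 := fun i => nth x.2 [:: x.1; f'; x.2] i.
pose cy0 := fun i => nth y.2 [:: y.1; f; y.2] i.
have Ux : near x (cx0 0%N, cx0 2%N) by rewrite /cx0 /= -surjective_pairing; apply: near_refl.
have Uy0 : U (cy0 0%N, cy0 2%N) by rewrite /cy0 /= -surjective_pairing.
have chx : chain 2 o cx0 by case=> [|[|]].
have chy : chain 2 o cy0 by case=> [|[|]].
have [z [cz xz Uz]] := chain_irreducible chx chy (zariski_open_near x) oU
  (leq0n 2) (leqnn 2) (leq0n 2) (leqnn 2) Ux Uy0.
have Cz : composites e e' (z 0%N, z 2%N).
  by exists (z 1%N); split; [apply: (cz 0%N) | apply: (cz 1%N)].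
apply: (@orbit_inj _ _ _ _ (z 0%N, z 2%N)); first by rewrite oE.
by have [c c'] := comp _ Cz; apply: near_gl_orbit (gx _ Cz).
Qed.

Lemma generic_composites (e e' : orbit) : complete_pairs e -> complete_pairs e' ->
  exists x, generic (composites e e') x.
Proof.
move=> ce ce'; have [x ex] := orbit_inhabited e; have [_ cx] := ce x ex.
have [f ef] := complete_right ce' cx.
pose o i := if i is 0 then e else e'.
have cz : chain 2 o (nth f [:: x.1; x.2; f]).
  by case=> [|[|]] //= _; rewrite -?surjective_pairing.
have [z [cz' zmax]] := chain_generic cz; exists (z 0%N, z 2%N).
split; first by exists (z 1%N); split; [apply: (cz' 0%N) | apply: (cz' 1%N)].
move=> y [f' [h h']]; rewrite [y]surjective_pairing.
by apply: (zmax (nth y.2 [:: y.1; f'; y.2])); case=> [|[|]].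
Qed.

Lemma open_orbit_sub (e e' : orbit) : complete_pairs e -> complete_pairs e' ->
  (val (open_orbit e e') `<=` composites e e')%classic.
Proof.
move=> ce ce'; have [x gx] := generic_composites ce ce'.
by have [[so _] _] := open_orbit_generic ce ce' gx.
Qed.

Lemma complete_open_orbit (e e' : orbit) : complete_pairs e -> complete_pairs e' ->
  complete_pairs (open_orbit e e').
Proof.
by move=> ce ce' x /(open_orbit_sub ce ce')[f [/ce[/= c1 _] /ce'[/= _ c2]]].
Qed.

Lemma star_basis_open_orbit (e e' : orbit) : complete_pairs e -> complete_pairs e' ->
  star_basis e e' = << open_orbit e e' >>.
Proof.
move=> ce ce'; rewrite /star_basis asboolT //.
by have [x [Cx _]] := generic_composites ce ce'; exists x.
Qed.

Definition corbit : Type := {o : orbit | `[< complete_pairs o >]}.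

Lemma corbitP (o : corbit) : complete_pairs (val o).
Proof. exact/asboolP/(valP o). Qed.

Lemma corbit_mul_subproof (e e' : corbit) :
  `[< complete_pairs (open_orbit (val e) (val e')) >].
Proof. by apply/asboolP/complete_open_orbit; apply: corbitP. Qed.

Definition corbit_mul (e e' : corbit) : corbit :=
  exist _ (open_orbit (val e) (val e')) (corbit_mul_subproof e e').

Lemma corbit_one_subproof : `[< complete_pairs (orbit_of (std_flag V, std_flag V)) >].
Proof.
apply/asboolP/(@completeP _ _ _ (std_flag V, std_flag V)); last exact: std_flag_complete.
  exact: gl_orbit_refl.
exact: std_flag_complete.
Qed.

Definition corbit_one : corbit :=
  exist _ (orbit_of (std_flag V, std_flag V)) corbit_one_subproof.

Definition in_corbit (o : corbit) f f' : Prop := val (val o) (f, f').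

Lemma in_corbitC o f f' : in_corbit o f f' -> complete f /\ complete f'.
Proof. exact: corbitP. Qed.

Lemma in_corbit_inj o o' f f' : in_corbit o f f' -> in_corbit o' f f' -> o = o'.
Proof. by move=> h h'; apply/val_inj/(orbit_inj h h'). Qed.

Lemma in_corbit_capd o f f' g g' : in_corbit o f f' -> complete g -> complete g' ->
  (forall a b, (a <= N)%N -> (b <= N)%N -> capd f f' a b = capd g g' a b) ->
  in_corbit o g g'.
Proof.
move=> h cg cg' same; have [cf cf'] := in_corbitC h.
by rewrite /in_corbit (Defs.orbitE h); apply: same_capd_orbit.
Qed.

Lemma corbit_mul_sub e e' f f' : in_corbit (corbit_mul e e') f f' ->
  exists2 f1, in_corbit e f f1 & in_corbit e' f1 f'.
Proof. by case/(open_orbit_sub (@corbitP e) (@corbitP e')) => f1 [? ?]; exists f1. Qed.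

Lemma corbit_mul_generic e e' f f1 f' : in_corbit e f f1 -> in_corbit e' f1 f' ->
  (forall g g1 g', in_corbit e g g1 -> in_corbit e' g1 g' -> near (g, g') (f, f')) ->
  in_corbit (corbit_mul e e') f f'.
Proof.
move=> h h' gen; apply: (open_orbit_generic (@corbitP e) (@corbitP e') _).2.
by split=> [|[g g'] [g1 [/= hg hg']]]; [exists f1 | apply: gen hg hg'].
Qed.

Lemma corbit_ex (o : corbit) : exists f f', in_corbit o f f'.
Proof. by have [[f f'] h] := orbit_inhabited (val o); exists f, f'. Qed.

Lemma corbit_oneP f f' : in_corbit corbit_one f f' <-> f = f' /\ complete f.
Proof. exact: kdP. Qed.

Lemma corbit_mul1 : left_id corbit_one corbit_mul.
Proof.
move=> o; have [f [f' h]] := corbit_ex o; have [cf _] := in_corbitC h.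
apply: (@in_corbit_inj _ _ f f') => //; apply: (@corbit_mul_generic _ _ _ f) => //.
  exact/corbit_oneP.
move=> g g1 g' /corbit_oneP[<- _] hg; apply: gl_orbit_near.
by move: h; rewrite /in_corbit (Defs.orbitE hg).
Qed.

Lemma corbit_mulr1 : right_id corbit_one corbit_mul.
Proof.
move=> o; have [f [f' h]] := corbit_ex o; have [_ cf] := in_corbitC h.
apply: (@in_corbit_inj _ _ f f') => //; apply: (@corbit_mul_generic _ _ _ f') => //.
  exact/corbit_oneP.
move=> g g1 g' hg /corbit_oneP[<- _]; apply: gl_orbit_near.
by move: h; rewrite /in_corbit (Defs.orbitE hg).
Qed.

Definition corbit3 (e1 e2 e3 : corbit) : set (flag * flag) :=
  [set x | exists f1 f2,
     [/\ in_corbit e1 x.1 f1, in_corbit e2 f1 f2 & in_corbit e3 f2 x.2]]%classic.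

Lemma corbit3_generic e1 e2 e3 : exists x, generic (corbit3 e1 e2 e3) x.
Proof.
have [f0 [f1 h1]] := corbit_ex e1; have [_ c1] := in_corbitC h1.
have [f2 h2] := complete_right (@corbitP e2) c1; have [_ c2] := in_corbitC h2.
have [f3 h3] := complete_right (@corbitP e3) c2.
pose o i : orbit := val (nth e3 [:: e1; e2; e3] i).
have ch : chain 3 o (nth f3 [:: f0; f1; f2; f3]) by case=> [|[|[|]]].
have [z [cz zmax]] := chain_generic ch; exists (z 0%N, z 3%N).
split.
  by exists (z 1%N), (z 2%N); split; [apply: (cz 0%N)|apply: (cz 1%N)|apply: (cz 2%N)].
move=> [g g'] [g1 [g2 [/= k1 k2 k3]]].
by apply: (zmax (nth g' [:: g; g1; g2; g'])); case=> [|[|[|]]].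
Qed.

(** Along a generic chain [f0, f1, f2, f3] the pairs [(f0, f2)] and [(f1, f3)] can
    be assumed generic too, by irreducibility of the variety of chains. *)
Lemma corbit3_mul e1 e2 e3 x : generic (corbit3 e1 e2 e3) x ->
  in_corbit (corbit_mul (corbit_mul e1 e2) e3) x.1 x.2 /\
  in_corbit (corbit_mul e1 (corbit_mul e2 e3)) x.1 x.2.
Proof.
case: x => f0 f3 [[f1 [f2 [/= h1 h2 h3]]] xmax].
have [c0 c1] := in_corbitC h1; have [c2 c3] := in_corbitC h3.
pose o i : orbit := val (nth e3 [:: e1; e2; e3] i).
have chx : chain 3 o (nth f3 [:: f0; f1; f2; f3]) by case=> [|[|[|]]].
have same (z : nat -> flag) e e' : chain 3 o z -> near (f0, f3) (z 0%N, z 3%N) ->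
    (forall g g1 g', in_corbit e g g1 -> in_corbit e' g1 g' -> corbit3 e1 e2 e3 (g, g')) ->
    (exists2 g1, in_corbit e (z 0%N) g1 & in_corbit e' g1 (z 3%N)) ->
    in_corbit (corbit_mul e e') f0 f3.
  move=> cz xz sub [g1 k1 k2].
  have hz : in_corbit (corbit_mul e e') (z 0%N) (z 3%N).
    apply: corbit_mul_generic k1 k2 _ => g g1' g' l1 l2.
    exact: near_trans (xmax _ (sub _ _ _ l1 l2)) xz.
  have [d0 d3] := in_corbitC hz.
  rewrite /in_corbit (Defs.orbitE hz); apply: near_gl_orbit => //.
  by apply: xmax; apply: sub k1 k2.
split.
  have [y [[g1 [k1 k2]] ymax]] := generic_composites (@corbitP e1) (@corbitP e2).
  have [g3 k3] := complete_right (@corbitP e3) (in_corbitC k2).2.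
  have chy : chain 3 o (nth g3 [:: y.1; g1; y.2; g3]) by case=> [|[|[|]]].
  have yy : near y (y.1, y.2) by rewrite -surjective_pairing; apply: near_refl.
  have [z [cz xz yz]] := chain_irreducible chx chy (zariski_open_near (f0, f3))
    (zariski_open_near y) (leq0n 3) (leqnn 3) (leq0n 3) (leqnSn 2)
    (@near_refl (f0, f3)) yy.
  apply: (same z) => // [g g2 g' /corbit_mul_sub[g1' l1 l2] l3|].
    by exists g1', g2.
  exists (z 2%N); last exact: (cz 2%N).
  apply: (@corbit_mul_generic _ _ _ (z 1%N)); [exact: (cz 0%N)|exact: (cz 1%N)|].
  by move=> g g1' g' l1 l2; apply: near_trans yz; apply: ymax; exists g1'.
have [y [[g2 [k2 k3]] ymax]] := generic_composites (@corbitP e2) (@corbitP e3).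
have [g0 k1] := complete_left (@corbitP e1) (in_corbitC k2).1.
have chy : chain 3 o (nth y.2 [:: g0; y.1; g2; y.2]) by case=> [|[|[|]]].
have yy : near y (y.1, y.2) by rewrite -surjective_pairing; apply: near_refl.
have [z [cz xz yz]] := chain_irreducible chx chy (zariski_open_near (f0, f3))
  (zariski_open_near y) (leq0n 3) (leqnn 3) (isT : 1 <= 3)%N (leqnn 3)
  (@near_refl (f0, f3)) yy.
apply: (same z) => // [g g1 g' l1 /corbit_mul_sub[g2' l2 l3]|].
  by exists g1, g2'.
exists (z 1%N); first exact: (cz 0%N).
apply: (@corbit_mul_generic _ _ _ (z 2%N)); [exact: (cz 1%N)|exact: (cz 2%N)|].
by move=> g g1' g' l1 l2; apply: near_trans yz; apply: ymax; exists g1'.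
Qed.

Lemma corbit_mulA : associative corbit_mul.
Proof.
move=> e1 e2 e3; have [x gx] := corbit3_generic e1 e2 e3.
by have [h h'] := corbit3_mul gx; apply: in_corbit_inj h' h.
Qed.

(** Products of three orbits are compared as relations between flags, which is
    how the braid relation is obtained. *)
Lemma eq_corbit3_mul e1 e2 e3 e1' e2' e3' :
  corbit3 e1 e2 e3 = corbit3 e1' e2' e3' ->
  corbit_mul (corbit_mul e1 e2) e3 = corbit_mul (corbit_mul e1' e2') e3'.
Proof.
move=> eq3; have [x gx] := corbit3_generic e1 e2 e3.
have [h _] := corbit3_mul gx; rewrite eq3 in gx; have [h' _] := corbit3_mul gx.
exact: in_corbit_inj h h'.
Qed.

End OrbitMonoid.

(** * Normal forms in the 0-Hecke monoid *)

Section Words.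
Implicit Types (u v w : seq nat) (i j l m n : nat).

(** The congruence of the 0-Hecke monoid on words in the letters [0, ..., n - 1].
    Working with words lets the same rewriting be used in the monoid of orbits
    and in the 0-Hecke algebra. *)
Inductive hecke_equiv n : seq nat -> seq nat -> Prop :=
| hecke_equiv_refl w : hecke_equiv n w w
| hecke_equiv_sym w w' : hecke_equiv n w w' -> hecke_equiv n w' w
| hecke_equiv_trans w w' w'' :
    hecke_equiv n w w' -> hecke_equiv n w' w'' -> hecke_equiv n w w''
| hecke_equiv_cat u v w w' :
    hecke_equiv n w w' -> hecke_equiv n (u ++ w ++ v) (u ++ w' ++ v)
| hecke_equiv_idem i : (i < n)%N -> hecke_equiv n [:: i; i] [:: i]
| hecke_equiv_braid i : (i.+1 < n)%N ->
    hecke_equiv n [:: i; i.+1; i] [:: i.+1; i; i.+1]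
| hecke_equiv_comm i j : (i.+1 < j)%N -> (j < n)%N ->
    hecke_equiv n [:: i; j] [:: j; i].

Definition hecke_relations (T : Type) (op : T -> T -> T) n (e : nat -> T) : Prop :=
  [/\ forall i, (i < n)%N -> op (e i) (e i) = e i,
      forall i, (i.+1 < n)%N ->
        op (op (e i) (e i.+1)) (e i) = op (op (e i.+1) (e i)) (e i.+1) &
      forall i j, (i.+1 < j)%N -> (j < n)%N -> op (e i) (e j) = op (e j) (e i)].

Lemma hecke_equiv_big (T : Type) (idx : T) (op : Monoid.law idx) n (e : nat -> T) w w' :
  hecke_relations op n e -> hecke_equiv n w w' ->
  \big[op/idx]_(i <- w) e i = \big[op/idx]_(i <- w') e i.
Proof.
move=> [idem braid comm]; elim=> //.
- by move=> w1 w2 w3 _ -> _ ->.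
- by move=> u v w1 w2 _ IH; rewrite !big_cat /= IH.
- by move=> i i_n; rewrite !big_cons !big_nil !Monoid.mulm1 idem.
- by move=> i /braid; rewrite !big_cons !big_nil !Monoid.mulm1 -!Monoid.mulmA.
- by move=> i j ij j_n; rewrite !big_cons !big_nil !Monoid.mulm1 comm.
Qed.

Lemma hecke_equiv_catl n u w w' : hecke_equiv n w w' -> hecke_equiv n (u ++ w) (u ++ w').
Proof. by move=> /(hecke_equiv_cat u [::]); rewrite !cats0. Qed.

Lemma hecke_equiv_catr n v w w' : hecke_equiv n w w' -> hecke_equiv n (w ++ v) (w' ++ v).
Proof. exact: (hecke_equiv_cat [::] v). Qed.

(** The descending word [m, m - 1, ..., j], empty when [j = m.+1]. *)
Definition run m j := rev (iota j (m.+1 - j)).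

Lemma runS m : run m m.+1 = [::]. Proof. by rewrite /run subnn. Qed.

Lemma run_rcons m j : (j <= m)%N -> run m j = rcons (run m j.+1) j.
Proof. by move=> jm; rewrite /run subSn //= rev_cons subSS. Qed.

Lemma mem_run m j i : (i \in run m j) = (j <= i <= m)%N.
Proof.
rewrite mem_rev mem_iota; case: (leqP j m.+1) => jm; first by rewrite subnKC.
rewrite (eqP (ltnW jm : (m.+1 - j)%N == 0%N)) addn0.
by apply/andP/andP => -[ji im]; exfalso; lia.
Qed.

Lemma hecke_equiv_swap n i w : (forall l, l \in w -> (i.+1 < l < n)%N) ->
  hecke_equiv n (rcons w i) (i :: w).
Proof.
elim: w => [|l w IHw] wP; first exact: hecke_equiv_refl.
have /andP[il ln] := wP l (mem_head _ _).
apply: (hecke_equiv_trans (w' := [:: l, i & w])).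
  by apply: (hecke_equiv_catl [:: l]); apply: IHw => l' l'w; apply: wP; rewrite inE l'w orbT.
apply: (hecke_equiv_catr w (w := [:: l; i]) (w' := [:: i; l])).
exact/hecke_equiv_sym/hecke_equiv_comm.
Qed.

(** The letter [i] is absorbed when [i = j], extends the descending word when
    [i = j - 1], commutes with it when [i < j - 1], and crosses it as [i - 1]
    through a braid relation when [i > j]. *)
Lemma run_mul n m j i : (m < n)%N -> (j <= m.+1)%N -> (i <= m)%N ->
  (exists2 i', (i' < m)%N & hecke_equiv n (rcons (run m j) i) (i' :: run m j)) \/
  (exists2 j', (j' <= m.+1)%N & hecke_equiv n (rcons (run m j) i) (run m j')).
Proof.
move=> mn jm im; case: (ltngtP i j) => [ij|ji|eq_ij].
- have [->|ij'] := eqVneq j i.+1.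
    by right; exists i; [exact: ltnW | rewrite -run_rcons //; apply: hecke_equiv_refl].
  left; exists i; first by lia.
  by apply: hecke_equiv_swap => l; rewrite mem_run; lia.
- left; exists i.-1; first by lia.
  have [d dE] : exists d, i = (j + d).+1 by exists (i - j).-1; lia.
  elim: d j dE {jm ji} => [|d IHd] j iE.
    rewrite addn0 in iE; rewrite iE /=; have jm : (j < m)%N by lia.
    rewrite (run_rcons (ltnW jm)) (run_rcons jm) -!cats1 -!catA /=.
    apply: (hecke_equiv_trans (w' := run m j.+2 ++ [:: j; j.+1; j])).
      apply: hecke_equiv_catl; apply/hecke_equiv_sym/hecke_equiv_braid; lia.
    rewrite -cat_rcons; apply: (hecke_equiv_catr _ (w' := j :: _)).
    by apply: hecke_equiv_swap => l; rewrite mem_run; lia.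
  have jm : (j <= m)%N by lia.
  rewrite (run_rcons jm) -!cats1 -!catA /=.
  apply: (hecke_equiv_trans (w' := run m j.+1 ++ [:: i; j])).
    by apply/hecke_equiv_catl/hecke_equiv_comm; lia.
  rewrite -cat_rcons; apply: (hecke_equiv_catr _ (w' := i.-1 :: _)).
  by apply: IHd; lia.
- right; exists j => //; rewrite eq_ij in im *; rewrite run_rcons // -!cats1 -catA /=.
  by apply/hecke_equiv_catl/hecke_equiv_idem; lia.
Qed.

(** The word [run m j] has [m.+2] possible values, so there are [m.+1`!] normal
    forms in the letters below [m], as many as permutations. *)
Inductive normal_form : nat -> seq nat -> Prop :=
| normal_form0 : normal_form 0 [::]
| normal_formS m w j : normal_form m w -> (j <= m.+1)%N ->
    normal_form m.+1 (w ++ run m j).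

Lemma normal_form_lt m w : normal_form m w -> forall i, i \in w -> (i < m)%N.
Proof.
elim=> // m' w' j _ IH jm i; rewrite mem_cat mem_run => /orP[/IH|]; lia.
Qed.

Lemma normal_form_nil m : normal_form m [::].
Proof.
elim: m => [|m IHm]; first exact: normal_form0.
by have := normal_formS IHm (leqnn m.+1); rewrite runS.
Qed.

Lemma normal_form_rcons n m w i : normal_form m w -> (m <= n)%N -> (i < m)%N ->
  exists2 w', normal_form m w' & hecke_equiv n (rcons w i) w'.
Proof.
move=> nw; elim: nw i => // m' w' j nw' IH jm i mn im; rewrite -cats1 -catA cats1.
case: (run_mul mn jm im) => [[i' im' eqr]|[j' jm' eqr]]; last first.
  by exists (w' ++ run m' j'); [exact: normal_formS | exact: hecke_equiv_catl].
have [w1 nw1 eqw1] := IH i' (ltnW mn) im'.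
exists (w1 ++ run m' j); first exact: normal_formS.
apply: hecke_equiv_trans (hecke_equiv_catl w' eqr) _.
by rewrite -cat_rcons; apply: hecke_equiv_catr.
Qed.

Lemma hecke_normal_form n w : (forall i, i \in w -> (i < n)%N) ->
  exists2 w', normal_form n w' & hecke_equiv n w w'.
Proof.
elim/last_ind: w => [|w i IHw] wP.
  by exists [::]; [exact: normal_form_nil | exact: hecke_equiv_refl].
have [|w1 nw1 eqw1] := IHw.
  by move=> l lw; apply: wP; rewrite mem_rcons inE lw orbT.
have i_n : (i < n)%N by apply: wP; rewrite mem_rcons mem_head.
have [w2 nw2 eqw2] := normal_form_rcons nw1 (leqnn n) i_n.
exists w2 => //; apply: hecke_equiv_trans eqw2.
by rewrite -!cats1; apply: hecke_equiv_catr.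
Qed.

End Words.

(** * The generators and their relations *)

Section Generators.
Variables (k : closedFieldType) (V : vectType k).
Local Notation N := (\dim {: V}).
Local Notation flag := (flag V).
Local Notation corbit := (corbit V).
Implicit Types (f g h : flag) (U W A B C : {vspace V}).

Lemma subv_dim_eq U W : (U <= W)%VS -> (\dim W <= \dim U)%N -> U = W.
Proof. by move=> UW dW; apply/eqP; rewrite eqEdim UW. Qed.

(** If [u] avoids [A] and [w] avoids [B], one of [u], [w], [u + w] avoids both. *)
Lemma subv_avoid2 A B C : ~~ (C <= A)%VS -> ~~ (C <= B)%VS ->
  exists2 v, v \in C & (v \notin A) && (v \notin B).
Proof.
move=> /subvPn[u uC uA] /subvPn[w wC wB].
have [uB|uB] := boolP (u \in B); last by exists u; rewrite ?uA.
have [wA|wA] := boolP (w \in A); last by exists w; rewrite ?wA.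
exists (u + w); first exact: memvD.
by rewrite rpredDr // uA rpredDl.
Qed.

Lemma dim_capv_hyperplane A B C : (A <= C)%VS -> (B <= C)%VS ->
  \dim C = (\dim B).+1 -> ~~ (A <= B)%VS -> (\dim (A :&: B)).+1 = \dim A.
Proof.
move=> AC BC dC AB; have := dimv_sum_cap A B.
suff -> : (A + B)%VS = C by rewrite dC; lia.
apply: subv_dim_eq; first by rewrite subv_add AC.
rewrite dC ltnNge; apply: contraNN AB => le.
have /subv_dim_eq -> // := addvSr A B; exact: addvSl.
Qed.

Lemma st_replace f s W : complete f -> (0 < s < N)%N ->
    (st f s.-1 <= W)%VS -> (W <= st f s.+1)%VS -> \dim W = s ->
  exists g, [/\ complete g, st g s = W &
    forall a, (a <= N)%N -> a != s -> st g a = st f a].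
Proof.
move=> cf /andP[s0 sN] fW Wf dW.
pose F a := if a == s then W else st f a.
have [|||g gF] := @flag_of_steps _ _ F.
- by rewrite /F ltn_eqF // st0.
- by rewrite /F gtn_eqF // stN.
- move=> a aN; rewrite /F; case: (eqVneq a s) => [->|as_].
    by rewrite (gtn_eqF (ltnSn s)).
  by case: eqVneq => [as'|_]; [rewrite -as' in fW *; exact: fW | exact: st_le].
exists g; split=> [||a aN as_]; last by rewrite gF // /F (negPf as_).
  by apply: completeE => a aN; rewrite gF // /F; case: eqP => [->|_] //; rewrite dim_st.
by rewrite gF ?(ltnW sN) // /F eqxx.
Qed.

Definition differ s f g : Prop :=
  [/\ complete f, complete g, st f s != st g s &
      forall a, (a <= N)%N -> a != s -> st f a = st g a].

(** A line of the plane between the steps [s.-1] and [s.+1], other than the lines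
    given by [f] and [f']. *)
Lemma differ2_ex s f f' : (0 < s < N)%N -> complete f -> complete f' ->
    (forall a, (a <= N)%N -> a != s -> st f a = st f' a) ->
  exists g, differ s f g /\ differ s g f'.
Proof.
move=> sN cf cf' ff'; have /andP[s0 s1] := sN.
have eqm : st f s.-1 = st f' s.-1 by apply: ff'; lia.
have eqp : st f s.+1 = st f' s.+1 by apply: ff'; lia.
have [|| v vC /andP[vf vf']] := @subv_avoid2 (st f s) (st f' s) (st f s.+1).
- by apply: contraL isT => /dimvS; rewrite !dim_st ?ltnn //; lia.
- by apply: contraL isT => /dimvS; rewrite !dim_st ?ltnn //; lia.
have vm : v \notin st f s.-1 by apply: contraNN vf; apply/subvP/st_le/leq_pred.
have [||| g [cg gs gf]] := @st_replace f s (st f s.-1 + <[v]>)%VS cf sN.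
- exact: addvSl.
- by rewrite subv_add st_le ?leq_pred //= -?memvE //; lia.
- by rewrite dim_addv_line // dim_st // ?prednK //; lia.
have vg : v \in st g s by rewrite gs memvE addvSr.
exists g; split; split=> //.
- by apply: contraNneq vf => ->.
- by move=> a aN as_; rewrite gf.
- by apply: contraNneq vf' => <-.
- by move=> a aN as_; rewrite gf // ff'.
Qed.

Lemma capd_eq f f' a b : complete f -> complete f' -> (a <= N)%N -> (b <= N)%N ->
  (st f a = st f' a) \/ (st f b = st f' b) -> capd f f' a b = minn a b.
Proof.
move=> cf cf' aN bN; have cap g : complete g -> \dim (st g a :&: st g b) = minn a b.
  move=> cg; case: (leqP a b) => ab.
    by rewrite (capv_idPl (st_le g ab)) dim_st.
  by rewrite (capv_idPr (st_le g (ltnW ab))) dim_st.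
by rewrite /capd => -[->|<-]; apply: cap.
Qed.

Lemma differ_capd s f g : (0 < s < N)%N -> differ s f g -> capd f g s s = s.-1.
Proof.
move=> sN [cf cg fg eqfg]; have eqm : st f s.-1 = st g s.-1 by apply: eqfg; lia.
have eqp : st f s.+1 = st g s.+1 by apply: eqfg; lia.
have dC : \dim (st g s.+1) = (\dim (st g s)).+1 by rewrite !dim_st //; lia.
have := @dim_capv_hyperplane (st f s) _ _ _ (st_le g (leqnSn s)) dC.
rewrite -eqp st_le // dim_st //; last by lia.
have nle : ~~ (st f s <= st g s)%VS.
  apply: contraNN fg => le; apply/eqP/(subv_dim_eq le); rewrite !dim_st //; lia.
by move/(_ isT nle); rewrite /capd; lia.
Qed.

Lemma in_corbit_same_capd (o : corbit) f f' g g' a b :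
  in_corbit o f f' -> in_corbit o g g' -> (a <= N)%N -> (b <= N)%N ->
  capd f f' a b = capd g g' a b.
Proof.
move=> h h' aN bN; have [[cf cf'] [cg cg']] := (in_corbitC h, in_corbitC h').
have /gl_orbit_near/nearE l : gl_orbit (f, f') (g, g').
  by move: h'; rewrite /in_corbit (Defs.orbitE h).
have /gl_orbit_near/nearE l' : gl_orbit (g, g') (f, f').
  by move: h; rewrite /in_corbit (Defs.orbitE h').
by apply/eqP; rewrite eqn_leq l ?l'.
Qed.

(** All the dimensions of intersections are the same for all these pairs, and they
    characterize them. *)
Lemma differ_corbit s : (0 < s < N)%N ->
  exists o : corbit, forall f g, in_corbit o f g <-> differ s f g.
Proof.
move=> sN; have cf : complete (std_flag V) := @std_flag_complete _ _.
have [g [dfg _]] := differ2_ex sN cf cf (fun _ _ _ => erefl).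
have [_ cg _ _] := dfg.
have oc : `[< complete_pairs (orbit_of (std_flag V, g)) >].
  by apply/asboolP/(@completeP _ _ _ (std_flag V, g)) => //; apply: gl_orbit_refl.
pose o : corbit := exist _ (orbit_of (std_flag V, g)) oc.
have og : in_corbit o (std_flag V) g by apply: gl_orbit_refl.
have dcapd f f' a b : differ s f f' -> (a <= N)%N -> (b <= N)%N ->
    capd f f' a b = if (a == s) && (b == s) then s.-1 else minn a b.
  move=> d aN bN; have [c c' _ e] := d; case: eqVneq => [->|as_] /=.
    case: eqVneq => [->|bs]; first exact: differ_capd.
    by apply: capd_eq => //; [lia | right; apply: e].
  by apply: capd_eq => //; left; apply: e.
exists o => f f'; split=> [h|d]; last first.
  have [c c' _ _] := d; apply: in_corbit_capd og c c' _ => a b aN bN.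
  by rewrite (dcapd _ _ _ _ dfg) ?(dcapd _ _ _ _ d).
have [c c'] := in_corbitC h.
have same a : (a <= N)%N -> capd f f' a a = if a == s then s.-1 else a.
  by move=> aN; rewrite -(in_corbit_same_capd og h) // (dcapd _ _ _ _ dfg) // andbb minnn.
split=> // [|a aN as_].
  apply/eqP => eqs; have sN' : (s <= N)%N by lia.
  have := same s sN'; rewrite eqxx capd_eq ?minnn //; [lia | by left].
have := same a aN; rewrite (negPf as_) /capd => d.
have /subv_dim_eq E : (st f a :&: st f' a <= st f a)%VS by apply: capvSl.
have /subv_dim_eq E' : (st f a :&: st f' a <= st f' a)%VS by apply: capvSr.
have le h0 : complete h0 -> (\dim (st h0 a) <= \dim (st f a :&: st f' a))%N.
  by move=> ch0; rewrite d (dim_st ch0 aN).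
exact: etrans (esym (E (le f c))) (E' (le f' c')).
Qed.

Lemma gen_ex i : exists o : corbit, (i.+1 < N)%N ->
  forall f g, in_corbit o f g <-> differ i.+1 f g.
Proof.
case: (ltnP i.+1 N) => [iN|_]; last by exists (corbit_one V).
by have [o oP] := @differ_corbit i.+1 iN; exists o.
Qed.

Definition gen : nat -> corbit := projT1 (choice gen_ex).

Lemma genP i f g : (i.+1 < N)%N -> in_corbit (gen i) f g <-> differ i.+1 f g.
Proof. by move=> iN; apply: (projT2 (choice gen_ex)). Qed.

(** The composite of the relation with itself consists of the relation and of the
    diagonal; the pairs that differ are the generic ones. *)
Lemma gen_idem i : (i.+1 < N)%N -> corbit_mul (gen i) (gen i) = gen i.
Proof.
move=> iN; have [f [f' h]] := corbit_ex (gen i).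
have /(genP _ _ iN) d := h; have [cf cf' _ eqf] := d.
have sN : (0 < i.+1 < N)%N by [].
have [g [dg dg']] := differ2_ex sN cf cf' eqf.
apply: (@in_corbit_inj _ _ _ _ f f') => //.
apply: (@corbit_mul_generic _ _ _ _ _ g); [exact/genP|exact/genP|].
move=> u v w /(genP _ _ iN)[cu _ _ eu] /(genP _ _ iN)[_ cw _ ew].
have euw a : (a <= N)%N -> a != i.+1 -> st u a = st w a by move=> aN ai; rewrite eu ?ew.
apply/(@nearE _ _ (u, w) (f, f') cu cw cf cf') => a b aN bN /=.
have [-> {a aN}|ai] := eqVneq a i.+1; last first.
  by rewrite !capd_eq //; left; [exact: euw|exact: eqf].
have [-> {b bN}|bi] := eqVneq b i.+1; last first.
  by rewrite !capd_eq //; try lia; right; [exact: euw|exact: eqf].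
have iN' : (i <= N)%N by lia.
rewrite differ_capd //= -[X in (X <= _)%N](dim_st cu iN') dimvS // subv_cap st_le //=.
by rewrite euw ?st_le //; lia.
Qed.

(** The two modified steps are not neighbours, so that they can be modified in
    either order. *)
Lemma differ_comm s t f g h : (0 < s < N)%N -> (0 < t < N)%N ->
    (s.+1 < t)%N || (t.+1 < s)%N -> differ s f g -> differ t g h ->
  exists2 g', differ t f g' & differ s g' h.
Proof.
move=> sN tN st_ [cf cg fg eqfg] [_ ch gh eqgh].
have [|||g' [cg' g't g'f]] := @st_replace f t (st h t) cf tN.
- by rewrite eqfg ?eqgh ?st_le ?leq_pred //; lia.
- by rewrite eqfg ?eqgh ?st_le //; lia.
- by rewrite dim_st //; lia.
exists g'; split=> //.
- by rewrite g't eqfg //; lia.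
- by move=> a aN at_; rewrite g'f.
- by rewrite g'f -?eqgh //; lia.
move=> a aN as_; have [->//|at_] := eqVneq a t.
by rewrite g'f // eqfg ?eqgh.
Qed.

Lemma eq_corbit_mul (e1 e2 e1' e2' : corbit) :
  (forall f f', (exists2 g, in_corbit e1 f g & in_corbit e2 g f') <->
                (exists2 g, in_corbit e1' f g & in_corbit e2' g f')) ->
  corbit_mul e1 e2 = corbit_mul e1' e2'.
Proof.
move=> eqe; rewrite -[LHS]corbit_mulr1 -[RHS]corbit_mulr1; apply: eq_corbit3_mul.
apply/seteqP; split=> -[f f'] [g [g' [/= h h' h'']]].
  have /eqe[g1 k1 k2] : exists2 g, in_corbit e1 f g & in_corbit e2 g g' by exists g.
  by exists g1, g'.
have /eqe[g1 k1 k2] : exists2 g, in_corbit e1' f g & in_corbit e2' g g' by exists g.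
by exists g1, g'.
Qed.

Lemma gen_comm i j : (i.+1 < j)%N -> (j.+1 < N)%N ->
  corbit_mul (gen i) (gen j) = corbit_mul (gen j) (gen i).
Proof.
move=> ij jN; have iN : (i.+1 < N)%N by lia.
apply: eq_corbit_mul => f f'; split=> -[g].
  move=> /(genP _ _ iN) d /(genP _ _ jN) d'.
  have [||| g' d1 d2] := differ_comm _ _ _ d d'; try lia.
  by exists g'; apply/genP.
move=> /(genP _ _ jN) d /(genP _ _ iN) d'.
have [||| g' d1 d2] := differ_comm _ _ _ d d'; try lia.
by exists g'; apply/genP.
Qed.

(** Both composites consist of the pairs that agree off [s] and [s.+1] and are in
    general position there: neither [s]-th step lies in the other [s.+1]-st step.
    The new middle step is the sum of the [s]-th steps of [f] and [f']. *)
Lemma differ_braid_up s f g h f' : (0 < s)%N -> (s.+1 < N)%N ->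
    differ s f g -> differ s.+1 g h -> differ s h f' ->
  exists g' h', [/\ differ s.+1 f g', differ s g' h' & differ s.+1 h' f'].
Proof.
move=> s0 sN [cf cg fg eqfg] [_ ch gh eqgh] [_ cf' hf' eqhf'].
have eqff' a : (a <= N)%N -> a != s -> a != s.+1 -> st f a = st f' a.
  by move=> aN a1 a2; rewrite eqfg ?eqgh ?eqhf'.
have gs : st g s = st h s by apply: eqgh; lia.
have fs : st f s.+1 = st g s.+1 by apply: eqfg; lia.
have f's : st f' s.+1 = st h s.+1 by rewrite eqhf' //; lia.
have dC : \dim (st f s.+2) = (\dim (st f' s.+1)).+1 by rewrite !dim_st //; lia.
have inter : (st f s.+1 :&: st f' s.+1)%VS = st g s.
  apply/esym/subv_dim_eq; first by rewrite subv_cap fs f's gs st_le // -gs st_le.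
  have : ~~ (st f s.+1 <= st f' s.+1)%VS.
    apply: contraNN gh => le; apply/eqP; rewrite -fs -f's.
    by apply: subv_dim_eq le _; rewrite !dim_st //; lia.
  move/(dim_capv_hyperplane (st_le f (leqnSn _)) _ dC); rewrite !dim_st //; try lia.
  by rewrite eqff' ?st_le //; lia.
have nf : ~~ (st f s <= st f' s.+1)%VS.
  apply: contraNN fg => le; apply/eqP; apply: subv_dim_eq; last by rewrite !dim_st //; lia.
  by rewrite -inter subv_cap st_le.
have nf' : ~~ (st f' s <= st f s.+1)%VS.
  apply: contraNN hf' => le; apply/eqP/esym; rewrite -gs.
  apply: subv_dim_eq; last by rewrite !dim_st //; lia.
  by rewrite -inter subv_cap le st_le.
pose J := (st f s + st f' s)%VS.
have fm : st f s.-1 = st f' s.-1 by apply: eqff'; lia.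
have fp : st f s.+2 = st f' s.+2 by apply: eqff'; lia.
have dJ : \dim J = s.+1.
  have := dimv_sum_cap (st f s) (st f' s); rewrite -/J !(dim_st _ (ltnW (ltnW sN))) //.
  have : (s.-1 <= \dim (st f s :&: st f' s))%N.
    have sm : (s.-1 <= N)%N by lia.
    by rewrite -[leqLHS](dim_st cf sm) dimvS // subv_cap {2}fm !st_le ?leq_pred.
  have : (\dim (st f s :&: st f' s) < s)%N.
    rewrite ltnNge; apply: contraNN nf' => le.
    have E : (st f s :&: st f' s)%VS = st f' s.
      by apply: subv_dim_eq (capvSr _ _) _; rewrite dim_st //; lia.
    by rewrite -E (subv_trans (capvSl _ _)) ?st_le.
  lia.
have fJ : (st f s <= J)%VS by apply: addvSl.
have f'J : (st f' s <= J)%VS by apply: addvSr.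
have JC : (J <= st f s.+2)%VS.
  by rewrite subv_add {2}fp !st_le // leqW.
have sN1 : (0 < s.+1 < N)%N by [].
have [g' [cg' g's g'f]] := st_replace cf sN1 fJ JC dJ.
have [|h' [ch' h's h'f]] := st_replace cf' sN1 f'J _ dJ; first by rewrite -fp.
exists g', h'; split; split=> //.
- by rewrite g's; apply: contraNneq nf' => ->.
- by move=> a aN as_; rewrite g'f.
- rewrite (g'f s (ltnW (ltnW sN)) (negbT (ltn_eqF (ltnSn s)))).
  rewrite (h'f s (ltnW (ltnW sN)) (negbT (ltn_eqF (ltnSn s)))).
  by apply: contraNneq nf => ->; rewrite st_le.
- move=> a aN as_; have [->|as1] := eqVneq a s.+1; first by rewrite g's.
  by rewrite g'f // h'f // eqff'.
- by rewrite h's; apply: contraNneq nf => <-.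
Qed.

(** The dual of [differ_braid_up]: the new middle step is the intersection of the
    [s.+1]-st steps of [f] and [f']. *)
Lemma differ_braid_down s f g h f' : (0 < s)%N -> (s.+1 < N)%N ->
    differ s.+1 f g -> differ s g h -> differ s.+1 h f' ->
  exists g' h', [/\ differ s f g', differ s.+1 g' h' & differ s h' f'].
Proof.
move=> s0 sN [cf cg fg eqfg] [_ ch gh eqgh] [_ cf' hf' eqhf'].
have eqff' a : (a <= N)%N -> a != s -> a != s.+1 -> st f a = st f' a.
  by move=> aN a1 a2; rewrite eqfg ?eqgh ?eqhf'.
have gs : st g s.+1 = st h s.+1 by apply: eqgh; lia.
have fs : st f s = st g s by apply: eqfg; lia.
have f's : st f' s = st h s by rewrite eqhf' //; lia.
have fm : st f s.-1 = st f' s.-1 by apply: eqff'; lia.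
have fp : st f s.+2 = st f' s.+2 by apply: eqff'; lia.
have dC : \dim (st f s.+2) = (\dim (st f' s.+1)).+1 by rewrite !dim_st //; lia.
(* The middle [s.+1]-st step is the sum of the two [s]-th steps. *)
have sub W : (st f s <= W)%VS -> (st f' s <= W)%VS -> (st g s.+1 <= W)%VS.
  move=> fW f'W; suff <- : (st f s + st f' s)%VS = st g s.+1 by rewrite subv_add fW.
  apply: subv_dim_eq; first by rewrite subv_add fs f's gs st_le // -gs st_le.
  rewrite (dim_st cg (ltnW sN)) ltnNge; apply: contraNN gh => le; rewrite -fs -f's.
  have E : st f s = (st f s + st f' s)%VS.
    by apply: subv_dim_eq (addvSl _ _) _; rewrite dim_st //; lia.
  apply/eqP/esym/subv_dim_eq; first by rewrite E addvSr.
  by rewrite !dim_st //; lia.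
have nf : ~~ (st f s <= st f' s.+1)%VS.
  apply: contraNN hf' => le; apply/eqP; rewrite -gs; apply: subv_dim_eq.
    by apply: sub => //; apply: st_le.
  by rewrite !dim_st //; lia.
have nf' : ~~ (st f' s <= st f s.+1)%VS.
  apply: contraNN fg => le; apply/eqP/esym; apply: subv_dim_eq.
    by apply: sub => //; apply: st_le.
  by rewrite !dim_st //; lia.
pose I := (st f s.+1 :&: st f' s.+1)%VS.
have dI : \dim I = s.
  have : ~~ (st f s.+1 <= st f' s.+1)%VS.
    by apply: contraNN nf; apply: subv_trans; rewrite st_le.
  move/(dim_capv_hyperplane (st_le f (leqnSn _)) _ dC); rewrite (dim_st cf (ltnW sN)).
  by rewrite fp st_le // => /(_ isT) [].
have fI : (st f s.-1 <= I)%VS by rewrite subv_cap {2}fm !st_le // leqW ?leq_pred.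
have f'I : (st f' s.-1 <= I)%VS by rewrite -fm.
have sN1 : (0 < s < N)%N by rewrite s0 ltnW.
have [g' [cg' g's g'f]] := st_replace cf sN1 fI (capvSl _ _) dI.
have [h' [ch' h's h'f]] := st_replace cf' sN1 f'I (capvSr _ _) dI.
exists g', h'; split; split=> //.
- by rewrite g's; apply: contraNneq nf => ->; apply: capvSr.
- by move=> a aN as_; rewrite g'f.
- rewrite (g'f s.+1 (ltnW sN) (negbT (gtn_eqF (ltnSn s)))).
  rewrite (h'f s.+1 (ltnW sN) (negbT (gtn_eqF (ltnSn s)))).
  by apply: contraNneq nf => <-; rewrite st_le.
- move=> a aN as_; have [->|as1] := eqVneq a s; first by rewrite g's.
  by rewrite g'f // h'f // eqff'.
- by rewrite h's; apply: contraNneq nf' => <-; apply: capvSl.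
Qed.

Lemma gen_braid i : (i.+2 < N)%N ->
  corbit_mul (corbit_mul (gen i) (gen i.+1)) (gen i) =
  corbit_mul (corbit_mul (gen i.+1) (gen i)) (gen i.+1).
Proof.
move=> iN2; have iN := ltnW iN2; apply: eq_corbit3_mul.
apply/seteqP; split=> -[f f'] [g [h [/= ]]].
  move=> /(genP _ _ iN) d1 /(genP _ _ iN2) d2 /(genP _ _ iN) d3.
  have [g' [h' [e1 e2 e3]]] := differ_braid_up (ltn0Sn i) iN2 d1 d2 d3.
  by exists g', h'; split; apply/genP.
move=> /(genP _ _ iN2) d1 /(genP _ _ iN) d2 /(genP _ _ iN2) d3.
have [g' [h' [e1 e2 e3]]] := differ_braid_down (ltn0Sn i) iN2 d1 d2 d3.
by exists g', h'; split; apply/genP.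
Qed.

Lemma gen_relations : hecke_relations (@corbit_mul k V) N.-1 gen.
Proof.
split=> [i iN|i iN|i j ij jN]; first by apply: gen_idem; lia.
  by apply: gen_braid; lia.
by apply: gen_comm; lia.
Qed.

End Generators.

(** * Normal forms enumerate the orbits *)

Section NormalForms.
Variables (k : closedFieldType) (V : vectType k).
Local Notation N := (\dim {: V}).
Local Notation flag := (flag V).
Local Notation corbit := (corbit V).
Implicit Types (f g h : flag) (w : seq nat).

HB.instance Definition _ := Monoid.isLaw.Build corbit (corbit_one V) (@corbit_mul k V)
  (@corbit_mulA k V) (@corbit_mul1 k V) (@corbit_mulr1 k V).

Definition gen_prod w : corbit := \big[@corbit_mul k V/corbit_one V]_(i <- w) gen V i.

Definition agree_above m f g : Prop :=
  forall a, (a <= N)%N -> (m < a)%N -> st f a = st g a.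

Lemma gen_prod_agree m w f g : (m < N)%N -> (forall i, i \in w -> (i < m)%N) ->
  in_corbit (gen_prod w) f g -> agree_above m f g.
Proof.
move=> mN; elim: w f => [|i w IHw] f wm; rewrite /gen_prod ?big_nil ?big_cons.
  by case/corbit_oneP => -> _ a.
have im : (i < m)%N by apply: wm; rewrite mem_head.
have iN : (i.+1 < N)%N := leq_ltn_trans im mN.
move=> /corbit_mul_sub[f1 /(genP _ _ iN)[_ _ _ eqf] /IHw h] a aN ma.
rewrite eqf ?h // => [j jw|]; first by apply: wm; rewrite inE jw orbT.
by rewrite gtn_eqF // (leq_ltn_trans im).
Qed.

(** The pairs of the orbit of [run m j]: [j] is the largest index of a step of
    [f'] contained in the step [m.+1] of [f], and [f] can be recovered from [f']
    and that step. *)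
Definition run_position m j f f' : Prop :=
  [/\ complete f /\ complete f',
      forall b, (b <= j)%N -> st f' b = st f b,
      forall b, (b <= N)%N -> (m.+1 < b)%N -> st f' b = st f b &
      forall b, (j < b <= m.+2)%N -> (st f' b :&: st f m.+1)%VS = st f b.-1].

(** The composite with the next generator replaces the step [j.+1] of the
    intermediate flag by another subspace of its step [j.+2]; the latter meets the
    step [m.+1] of [f] in the old step [j.+1], which the new one cannot contain. *)
Lemma gen_prod_run m j f f' : (m.+1 < N)%N -> (j <= m.+1)%N ->
  in_corbit (gen_prod (run m j)) f f' -> run_position m j f f'.
Proof.
move=> mN jm; have [d dE] : exists d, m.+1 = (j + d)%N by exists (m.+1 - j)%N; rewrite subnKC.
elim: d j dE f' {jm} => [|d IHd] j dE f'.
  rewrite addn0 in dE; rewrite -dE runS /gen_prod big_nil => /corbit_oneP[<- cf].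
  split=> // b /andP[mb bm]; have -> : b = m.+2 by lia.
  by rewrite capvC (capv_idPl (st_le f (leqnSn _))).
have jm : (j <= m)%N by lia.
rewrite run_rcons // /gen_prod -cats1 big_cat big_seq1 => /corbit_mul_sub[f1].
have dE' : m.+1 = (j.+1 + d)%N by lia.
have jN : (j.+1 < N)%N by lia.
move=> /(IHd _ dE')[[cf cf1] lo hi mid] /(genP _ _ jN)[_ cf' ne eqf1].
have jle : (j.+1 <= N)%N := ltnW jN.
split=> // [b bj|b bN mb|b /andP[jb bm]].
- by rewrite -eqf1 ?lo //; lia.
- by rewrite -eqf1 ?hi //; lia.
have bN : (b <= N)%N by lia.
have [eb|bj] := eqVneq b j.+1; last by rewrite -eqf1 // mid //; lia.
rewrite eb /=; apply/esym/subv_dim_eq.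
  rewrite -[X in (X <= _)%VS]lo // eqf1 //; [|lia|lia].
  by rewrite subv_cap st_le //= -eqf1 ?lo ?st_le //; lia.
rewrite (dim_st cf (ltnW jle)) -ltnS.
have sub : (st f' j.+1 :&: st f m.+1 <= st f j.+1)%VS.
  have -> : st f j.+1 = (st f1 j.+2 :&: st f m.+1)%VS by rewrite mid //; lia.
  by rewrite capvS // eqf1 ?st_le //; lia.
rewrite ltnNge; apply: contraNN ne => le.
have := dim_st cf jle; have := dim_st cf' jle => d1 d2.
have E : (st f' j.+1 :&: st f m.+1)%VS = st f j.+1 by apply: subv_dim_eq; rewrite ?d2.
rewrite lo // -E; apply/eqP/subv_dim_eq; first exact: capvSl.
by rewrite d1.
Qed.

Lemma run_position_inj m j j' f' g g' : (m.+1 < N)%N -> (j' <= m.+1)%N ->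
  st g m.+1 = st g' m.+1 -> run_position m j g f' -> run_position m j' g' f' -> (j' <= j)%N.
Proof.
move=> mN jm eqg [[cg cf'] lo hi mid] [[cg' _] lo' hi' mid'].
rewrite leqNgt; apply/negP => jj'.
have jN : (j.+1 <= N)%N by lia.
have := congr1 (fun U => \dim U) (mid j.+1 _); rewrite /= dim_st //; last by lia.
have /capv_idPl -> : (st f' j.+1 <= st g m.+1)%VS by rewrite eqg lo' // st_le //; lia.
by rewrite dim_st // => E; have := E _; lia.
Qed.

Lemma run_position_eq m j f' g g' : (m.+1 < N)%N -> (j <= m.+1)%N ->
  agree_above m g g' -> run_position m j g f' -> run_position m j g' f' -> g = g'.
Proof.
move=> mN jm eqg [_ lo hi mid] [_ lo' hi' mid']; apply: eq_flag => b bN.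
have [bj|jb] := leqP b j; first by rewrite -lo // lo'.
have [bm|mb] := leqP b m; last by apply: eqg.
have jb' : (j < b.+1 <= m.+2)%N by lia.
by rewrite -[st g b](mid _ jb') (eqg _ (ltnW mN) (ltnSn m)) mid'.
Qed.

(** The last descending word is read off the position of a pair of flags, then
    the intermediate flag is determined and the rest of the normal form follows
    by induction. *)
Lemma normal_form_inj m w w' : (m < N)%N -> normal_form m w -> normal_form m w' ->
  gen_prod w = gen_prod w' -> w = w'.
Proof.
move=> + nw; elim: nw w' => [|m' u j nu IHu jm] w' mN; first by move=> n0; inversion n0.
move=> n'; inversion n' as [|m0 u' j' nu' jm' e1 e2]; subst m0.
have mN' := ltnW mN.
rewrite /gen_prod !big_cat /= -!/(gen_prod _) => eqw.
have [f [f' h]] := corbit_ex (corbit_mul (gen_prod u) (gen_prod (run m' j))).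
move: (h); rewrite eqw => /corbit_mul_sub[g' hu' /(gen_prod_run mN jm') r'].
move: h => /corbit_mul_sub[g hu /(gen_prod_run mN jm) r].
have ag := gen_prod_agree mN' (normal_form_lt nu) hu.
have ag' := gen_prod_agree mN' (normal_form_lt nu') hu'.
have gg' : agree_above m' g g' by move=> a aN ma; rewrite -ag // ag'.
have gm : st g m'.+1 = st g' m'.+1 by apply: gg'.
have jj' : j = j'.
  apply/eqP; rewrite eqn_leq (run_position_inj mN jm (esym gm) r' r).
  by rewrite (run_position_inj mN jm' gm r r').
rewrite -jj' in r' *; congr (_ ++ _).
have eqg := run_position_eq mN jm gg' r r'; rewrite -eqg in hu'.
by apply: IHu => //; apply: in_corbit_inj hu hu'.
Qed.

(** The relative position of [f] and [f'] depends only on that of [f] and [g], so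
    that composing with the relation of a descending word yields a single orbit. *)
Lemma run_position_capd m j f g f' a b : (m.+1 < N)%N -> (j <= m.+1)%N ->
    complete f -> agree_above m f g -> run_position m j g f' -> (a <= N)%N -> (b <= N)%N ->
  capd f f' a b = if (m.+1 < a)%N || (m.+1 < b)%N then minn a b
                  else capd f g a (if (b <= j)%N then b else b.-1).
Proof.
move=> mN jm cf ag [[cg cf'] lo hi mid] aN bN; case: ltnP => [ma|am] /=.
  by apply: capd_eq => //; left; rewrite hi // -ag // ltnW.
case: ltnP => [mb|bm]; first by apply: capd_eq => //; right; rewrite hi // -ag // ltnW.
rewrite /capd; case: leqP => [bj|jb]; first by rewrite lo.
have jb' : (j < b <= m.+2)%N by rewrite jb leqW.
rewrite -(mid _ jb') -(ag m.+1 (ltnW mN) (leqnn _)) [X in _ = \dim (_ :&: X)]capvC capvA.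
by rewrite (capv_idPl (st_le f am)).
Qed.

(** The steps of [g] are those of [f'] as long as they lie in the step [m.+1] of
    [f], then the intersections of the next step of [f'] with it, and finally the
    steps of [f]. *)
Lemma run_position_ex m f f' : (m.+1 < N)%N -> complete f -> complete f' ->
    agree_above m.+1 f f' ->
  exists g j, [/\ (j <= m.+1)%N, complete g, agree_above m f g & run_position m j g f'].
Proof.
move=> mN cf cf' ag; have eqp : st f m.+2 = st f' m.+2 by apply: ag.
have pN : (m.+1 <= N)%N := ltnW mN.
pose P b := ~~ (st f' b <= st f m.+1)%VS.
have P2 : P m.+2 by apply/negP => /dimvS; rewrite !dim_st ?ltnn.
have exP : exists b, P b by exists m.+2.
(* [j.+1] is the first step of [f'] outside the step [m.+1] of [f]. *)
have [[|j] Pj jmin] := ex_minnP exP; first by move: Pj; rewrite /P st0 sub0v.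
have jm : (j <= m.+1)%N by rewrite -ltnS jmin.
have f'j : (st f' j <= st f m.+1)%VS by apply/negPn/negP => /jmin; rewrite ltnn.
have Pup b : (j < b)%N -> P b.
  by move=> jb; apply: contraNN Pj; apply: subv_trans (st_le f' jb).
have dcap b : (j < b <= m.+2)%N -> (\dim (st f' b :&: st f m.+1)).+1 = b.
  move=> /andP[/Pup Pb bm]; have bN : (b <= N)%N by lia.
  rewrite -[RHS](dim_st cf' bN); apply: (@dim_capv_hyperplane _ _ _ _ (st f m.+2)) => //.
  - by rewrite eqp st_le.
  - by rewrite st_le.
  - by rewrite !dim_st.
pose F b := if (b <= j)%N then st f' b
            else if (b <= m.+1)%N then (st f' b.+1 :&: st f m.+1)%VS else st f b.
have [|||g gF] := @flag_of_steps _ _ F.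
- by rewrite /F st0.
- by rewrite /F !ifF ?stN //; lia.
- move=> b bN; rewrite /F; case: (leqP b j) => bj.
    case: ltnP => [_|jb]; first exact: st_le.
    have -> : b = j by lia.
    case: ltnP => jm1; first by rewrite subv_cap f'j (st_le f' (leqW (leqnSn j))).
    have -> : j = m.+1 by lia.
    by rewrite eqp st_le.
  have -> : (b < j)%N = false by lia.
  case: (leqP b m.+1) => bm.
    case: ltnP => bm1; first by rewrite capvS ?st_le.
    have -> : b = m.+1 by lia.
    by rewrite (subv_trans (capvSr _ _)) ?st_le.
  by have -> : (b < m.+1)%N = false; [lia | rewrite st_le].
have cg : complete g.
  apply: completeE => b bN; rewrite gF // /F; case: leqP => [_|jb]; first by rewrite dim_st.
  case: leqP => [bm|_]; last by rewrite dim_st.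
  by have [] : (\dim (st f' b.+1 :&: st f m.+1)).+1 = b.+1 by apply: dcap; lia.
have agg : agree_above m f g.
  move=> b bN mb; rewrite gF // /F; case: leqP => [bj|jb].
    have eb : b = m.+1 by lia.
    have ej : j = m.+1 by lia.
    by apply/esym/subv_dim_eq; [rewrite eb -{1}ej | rewrite !dim_st].
  case: leqP => // bm; have -> : b = m.+1 by lia.
  by rewrite -eqp capvC (capv_idPl (st_le f (leqnSn _))).
exists g, j; split=> //; split=> // [b bj|b bN mb|b /andP[jb bm]].
- by rewrite gF /F ?bj //; lia.
- by rewrite -agg ?ag // ltnW.
rewrite -agg // gF /F; last by lia.
case: leqP => bj; last by rewrite ifT ?prednK //; lia.
have eb : b = j.+1 by lia.
rewrite eb /=; apply/esym/subv_dim_eq; first by rewrite subv_cap f'j st_le.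
by have := dcap b; rewrite eb dim_st //; lia.
Qed.

Lemma normal_form_surj m f f' : (m < N)%N -> complete f -> complete f' ->
  agree_above m f f' -> exists2 w, normal_form m w & in_corbit (gen_prod w) f f'.
Proof.
elim: m f' => [|m IHm] f' mN cf cf' ag.
  exists [::]; first exact: normal_form0.
  rewrite /gen_prod big_nil; apply/corbit_oneP; split=> //; apply: eq_flag => a aN.
  by case: a aN => [|a] aN; [rewrite !st0 | apply: ag].
have [g [j [jm cg agg r]]] := run_position_ex mN cf cf' ag.
have [w nw hw] := IHm g (ltnW mN) cf cg agg.
exists (w ++ run m j); first exact: normal_formS.
have [h [h' hh']] := corbit_ex (gen_prod (w ++ run m j)).
apply: (in_corbit_capd hh') => // a b aN bN.
move: hh'; rewrite /gen_prod big_cat /= -!/(gen_prod _).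
move=> /corbit_mul_sub[h1 hw' /(gen_prod_run mN jm) r'].
have [ch ch1] := in_corbitC hw'.
have agh := gen_prod_agree (ltnW mN) (normal_form_lt nw) hw'.
rewrite (run_position_capd mN jm ch agh r') // (run_position_capd mN jm cf agg r) //.
case: ifP => // /norP[_]; rewrite -leqNgt => bm; apply: in_corbit_same_capd hw' hw aN _.
by case: ifP => _ //; apply: leq_trans (leq_pred _) bN.
Qed.

Lemma gen_prod_surj (o : corbit) : (0 < N)%N ->
  exists2 w, (forall i, i \in w -> (i < N.-1)%N) & gen_prod w = o.
Proof.
move=> N0; have [f [f' h]] := corbit_ex o; have [cf cf'] := in_corbitC h.
have [||w nw hw] := @normal_form_surj N.-1 f f' _ cf cf'; first by rewrite prednK.
  by move=> a aN; rewrite prednK // => Na; rewrite !stN.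
by exists w; [exact: normal_form_lt nw | exact: in_corbit_inj hw h].
Qed.

(** With [gen_prod_surj] and [gen_relations], this presents the monoid of orbits
    as the 0-Hecke monoid. *)
Lemma gen_prod_equiv w w' : (0 < N)%N ->
    (forall i, i \in w -> (i < N.-1)%N) -> (forall i, i \in w' -> (i < N.-1)%N) ->
  gen_prod w = gen_prod w' -> hecke_equiv N.-1 w w'.
Proof.
move=> N0 /hecke_normal_form[u nu wu] /hecke_normal_form[u' nu' wu'].
rewrite /gen_prod (hecke_equiv_big (@gen_relations k V) wu).
rewrite (hecke_equiv_big (@gen_relations k V) wu') => eqw.
have uu' : u = u' by apply: (normal_form_inj _ nu nu' eqw); rewrite prednK.
by apply: hecke_equiv_trans wu _; rewrite uu'; apply: hecke_equiv_sym.
Qed.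

End NormalForms.

(** * Linear maps out of a free module *)

Section LinearExtensionOver.
Variables (K : comNzRingType) (I : choiceType) (W : lmodType K).

Definition free_lift (g : I -> W) (x : {malg K[I]}) : W :=
  \sum_(i <- msupp x) monalg.mcoeff i x *: g i.

Lemma free_liftEw g (d : {fset I}) x : fsubset (msupp x) d ->
  free_lift g x = \sum_(i <- d) monalg.mcoeff i x *: g i.
Proof.
move=> le; rewrite /free_lift (big_fset_incl _ le) // => i _ ix.
by rewrite mcoeff_outdom // scale0r.
Qed.

Lemma free_lift_is_zmod_morphism g : zmod_morphism (free_lift g).
Proof.
move=> x y; set d := fsetU (msupp x) (msupp y).
rewrite !(@free_liftEw g d) ?fsubsetUl ?fsubsetUr ?msuppB_le //.
by rewrite -sumrB; apply: eq_bigr => i _; rewrite monalg.mcoeffB scalerBl.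
Qed.

HB.instance Definition _ g := GRing.isZmodMorphism.Build {malg K[I]} W (free_lift g)
  (free_lift_is_zmod_morphism g).

Lemma free_liftD g x y : free_lift g (x + y) = free_lift g x + free_lift g y.
Proof. exact: raddfD. Qed.

Lemma free_liftB g x y : free_lift g (x - y) = free_lift g x - free_lift g y.
Proof. exact: raddfB. Qed.

Lemma free_liftU g c i : free_lift g << c *g i >> = c *: g i.
Proof. by rewrite (free_liftEw _ msuppU_le) big_seq_fset1 mcoeffUU. Qed.

Lemma free_liftU1 g i : free_lift g << i >> = g i.
Proof. by rewrite free_liftU scale1r. Qed.

Lemma free_liftZ g c x : free_lift g (c *: x) = c *: free_lift g x.
Proof.
rewrite (free_liftEw _ (monalg.msuppZ_le c x)) scaler_sumr; apply: eq_bigr => i _.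
by rewrite monalg.mcoeffZ scalerA.
Qed.

Lemma malgU_scale (c : K) (i : I) : << c *g i >> = c *: << i >> :> {malg K[I]}.
Proof. by apply/malgP => j; rewrite monalg.mcoeffZ !mcoeffU mulrnAr mulr1. Qed.

End LinearExtensionOver.

Section LinearExtensionProduct.
Variables (K : comNzRingType) (I : choiceType) (W : lmodType K).
Local Notation F := {malg K[{fmonom I}]}.

Lemma free_liftM (g : {fmonom I} -> W) (x y : F) :
  free_lift g (x * y) = \sum_(m <- msupp x) \sum_(m' <- msupp y)
    (monalg.mcoeff m x * monalg.mcoeff m' y) *: g (mmul m m').
Proof.
rewrite malgME raddf_sum; apply: eq_bigr => m _; rewrite raddf_sum.
by apply: eq_bigr => m' _; apply: free_liftU.
Qed.

Lemma free_liftMl (g : {fmonom I} -> W) (x y : F) :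
  free_lift g (x * y) =
    \sum_(m <- msupp x) monalg.mcoeff m x *: free_lift (fun m' => g (mmul m m')) y.
Proof.
rewrite free_liftM; apply: eq_bigr => m _; rewrite scaler_sumr.
by apply: eq_bigr => m' _; rewrite scalerA.
Qed.

Lemma free_liftMr (g : {fmonom I} -> W) (x y : F) :
  free_lift g (x * y) =
    \sum_(m' <- msupp y) monalg.mcoeff m' y *: free_lift (fun m => g (mmul m m')) x.
Proof.
rewrite free_liftM exchange_big; apply: eq_bigr => m' _; rewrite scaler_sumr.
by apply: eq_bigr => m _; rewrite scalerA mulrC.
Qed.

Lemma free_lift_scale (g g' : {fmonom I} -> W) c (x : F) :
  (forall m, g m = c *: g' m) -> free_lift g x = c *: free_lift g' x.
Proof.
move=> gg'; rewrite scaler_sumr; apply: eq_bigr => m _.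
by rewrite gg' !scalerA mulrC.
Qed.

Lemma malg_mulU (m m' : {fmonom I}) : << m >> * << m' >> = << mmul m m' >> :> F.
Proof. by rewrite malgM_def fgmulUU mulr1. Qed.

End LinearExtensionProduct.

(** * The algebra of the monoid of orbits *)

Section OrbitAlgebra.
Variables (K : comNzRingType) (k : closedFieldType) (V : vectType k).
Local Notation N := (\dim {: V}).
Local Notation corbit := (corbit V).
Local Notation orbit := (Defs.orbit V).
Local Notation tensor := (tensor (H0 V) K).
Hypothesis N_gt0 : (0 < N)%N.

Definition word_of (o : corbit) : seq nat :=
  s2val (cid2 (gen_prod_surj o N_gt0)).

Lemma word_of_lt o i : i \in word_of o -> (i < N.-1)%N.
Proof. by rewrite /word_of; case: cid2 => w /= h _; apply: h. Qed.

Lemma word_ofK o : gen_prod V (word_of o) = o.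
Proof. by rewrite /word_of; case: cid2. Qed.

Variables (A : algType K) (e : nat -> A).
Hypothesis e_relations : hecke_relations *%R N.-1 e.

Definition orbit_map (o : corbit) : A := \prod_(i <- word_of o) e i.

(** Two words with the same orbit are congruent, so that their images agree. *)
Lemma orbit_map_gen_prod w : (forall i, i \in w -> (i < N.-1)%N) ->
  orbit_map (gen_prod V w) = \prod_(i <- w) e i.
Proof.
move=> wN; apply: (hecke_equiv_big e_relations).
by apply: gen_prod_equiv (@word_of_lt _) wN _ => //; rewrite word_ofK.
Qed.

Lemma orbit_mapM o o' : orbit_map (corbit_mul o o') = orbit_map o * orbit_map o'.
Proof.
have lt : forall i, i \in word_of o ++ word_of o' -> (i < N.-1)%N.
  by move=> i; rewrite mem_cat => /orP[] /word_of_lt.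
rewrite -[in LHS](word_ofK o) -[in LHS](word_ofK o').
have -> : corbit_mul (gen_prod V (word_of o)) (gen_prod V (word_of o')) =
    gen_prod V (word_of o ++ word_of o') by rewrite /gen_prod big_cat.
by rewrite orbit_map_gen_prod // big_cat.
Qed.

Lemma orbit_map1 : orbit_map (corbit_one V) = 1.
Proof.
have -> : corbit_one V = gen_prod V [::] by rewrite /gen_prod big_nil.
by rewrite orbit_map_gen_prod // big_nil.
Qed.

Definition orbit_map_basis (o : orbit) : A := oapp orbit_map 0 (insub o : option corbit).

Lemma orbit_map_basisE (o : corbit) : orbit_map_basis (val o) = orbit_map o.
Proof. by rewrite /orbit_map_basis valK. Qed.

Lemma corbit_of (o : orbit) : complete_pairs o -> exists o' : corbit, o = val o'.
Proof. by move=> /asboolP co; exists (exist _ o co). Qed.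

Definition H0_map (a : H0 V) : A := linext orbit_map_basis (val a).

Lemma H0_mapD a b : H0_map (a + b) = H0_map a + H0_map b.
Proof. exact: linextD. Qed.

Lemma H0_mapM a b : H0_map (H0_mul a b) = H0_map a * H0_map b.
Proof.
rewrite /H0_map /= /star; have /H0P ha := valP a; have /H0P hb := valP b.
rewrite {2}/linext raddf_sum /= [in RHS]/linext mulr_suml.
apply: eq_big_seq => o /ha /corbit_of[{}o ->].
rewrite raddfMz /= mulrzAl; congr (_ *~ _).
rewrite {2}/linext raddf_sum /= mulr_sumr.
apply: eq_big_seq => o' /hb /corbit_of[{}o' ->].
rewrite raddfMz /= mulrzAr; congr (_ *~ _).
rewrite star_basis_open_orbit; [|exact: corbitP..].
by rewrite linextU (orbit_map_basisE (corbit_mul o o')) orbit_mapM !orbit_map_basisE.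
Qed.

Definition tensor_map : tensor -> A := tensor_lift (fun a c => c *: H0_map a).

Let liftDl a b c : c *: H0_map (a + b) = c *: H0_map a + c *: H0_map b.
Proof. by rewrite H0_mapD scalerDr. Qed.

Let liftDr a c d : (c + d) *: H0_map a = c *: H0_map a + d *: H0_map a.
Proof. by rewrite scalerDl. Qed.

Lemma tensor_mapE a c : tensor_map (tens a c) = c *: H0_map a.
Proof. exact: (tensor_liftE liftDl liftDr). Qed.

Lemma tensor_mapB x y : tensor_map (x - y) = tensor_map x - tensor_map y.
Proof. exact: (tensor_lift_is_zmod_morphism liftDl liftDr). Qed.

Lemma tensor_map0 : tensor_map 0 = 0.
Proof. by rewrite -[0 in LHS](subrr 0) tensor_mapB subrr. Qed.

Lemma tensor_mapZ c x : tensor_map (c *: x) = c *: tensor_map x.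
Proof.
elim/tensor_ind: x => [|a d|x y IHx IHy].
- by rewrite scaler0 tensor_map0 scaler0.
- rewrite tensZ; apply: etrans (tensor_mapE a (c * d)) _.
  by rewrite -scalerA; congr (_ *: _); apply/esym/tensor_mapE.
- by rewrite scalerBr !tensor_mapB IHx IHy scalerBr.
Qed.

Lemma tensor_map_is_linear : linear tensor_map.
Proof.
move=> c x y; have N z : tensor_map (- z) = - tensor_map z.
  by rewrite -sub0r tensor_mapB tensor_map0 sub0r.
by rewrite -[y in LHS]opprK tensor_mapB tensor_mapZ N opprK.
Qed.

HB.instance Definition _ := GRing.isLinear.Build K tensor A *:%R tensor_map
  tensor_map_is_linear.

Lemma tensor_map1 : tensor_map (tens (H0_one V) 1) = 1.
Proof.
rewrite tensor_mapE scale1r /H0_map /= linextU.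
by rewrite (orbit_map_basisE (corbit_one V)) orbit_map1.
Qed.

Lemma tensor_mapM x y :
  tensor_map (tensor_mul (@H0_mul k V) x y) = tensor_map x * tensor_map y.
Proof.
have [mDl mDr] := (@H0_mulDl k V, @H0_mulDr k V).
have mulBl := tensor_mulBl (K := K) mDl mDr; have mulBr := tensor_mulBr (K := K) mDl mDr.
elim/tensor_ind: x => [|a c|x x' IH IH'].
- by rewrite -[0 in LHS](subrr 0) mulBl subrr tensor_map0 mul0r.
- elim/tensor_ind: y => [|b d|y y' IH IH'].
  + by rewrite -[0 in LHS](subrr 0) mulBr subrr tensor_map0 mulr0.
  + apply: etrans (congr1 tensor_map (tensor_mulE mDl mDr a c b d)) _.
    apply: etrans (tensor_mapE _ _) (esym _).
    apply: etrans (congr2 *%R (tensor_mapE a c) (tensor_mapE b d)) _.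
    by rewrite H0_mapM -scalerAl -scalerAr scalerA.
  + by rewrite mulBr !tensor_mapB IH IH' mulrBr.
- by rewrite mulBl !tensor_mapB IH IH' mulrBl.
Qed.

End OrbitAlgebra.

(** * The isomorphism *)

(** If [t ^+ 2 = - t] then [- t] is idempotent, and both sides of the braid
    relation change sign. Letters beyond the last generator stand for the
    identity. *)
Lemma hecke_relations_opp (A : nzRingType) m (t : 'I_m -> A) :
    (forall i, t i * t i = - t i) ->
    (forall i j : 'I_m, j = i.+1 :> nat -> t i * t j * t i = t j * t i * t j) ->
    (forall i j : 'I_m, (i.+1 < j)%N -> t i * t j = t j * t i) ->
  hecke_relations *%R m (fun i => oapp (fun j => - t j) 1 (insub i)).
Proof.
move=> idem braid comm; have tE i (im : (i < m)%N) :
    oapp (fun j => - t j) 1 (insub i) = - t (Ordinal im) by rewrite insubT.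
split=> [i im|i im|i j ij jm].
- by rewrite tE mulrNN idem.
- by rewrite !tE ?(ltnW im) // => im'; rewrite !mulrNN !mulrN braid.
- by rewrite !tE ?(ltn_trans _ jm) ?(ltnW ij) // => im; rewrite !mulrNN comm.
Qed.

Lemma scale_prod_opp (K : comNzRingType) (A : algType K) I (s : seq I) (t : I -> A) :
  (-1) ^+ size s *: \prod_(i <- s) - t i = \prod_(i <- s) t i.
Proof.
elim: s => [|i s IHs]; first by rewrite !big_nil scale1r.
by rewrite !big_cons exprS mulN1r scaleNr mulNr scalerN opprK scalerAr IHs.
Qed.

Section Isomorphism.
Variables (K : comNzRingType) (k : closedFieldType) (V : vectType k).
Local Notation N := (\dim {: V}).
Local Notation corbit := (corbit V).
Local Notation F := {malg K[{fmonom 'I_N.-1}]}.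
Local Notation H := (hecke0 K N).
Local Notation tensor := (tensor (H0 V) K).
Hypothesis N_gt0 : (0 < N)%N.

Import Quotient.
Local Open Scope quotient_scope.

Definition hecke_pi (x : F) : H := \pi_({quot hecke_idealz K N}) x.

Lemma hecke_piB x y : hecke_pi (x - y) = hecke_pi x - hecke_pi y.
Proof. exact: (raddfB (\pi_({quot hecke_idealz K N}))). Qed.

Lemma hecke_piM x y : hecke_pi (x * y) = hecke_pi x * hecke_pi y.
Proof. exact: (esym (hecke_mulE x y)). Qed.

Lemma hecke_piZ c x : hecke_pi (c *: x) = c *: hecke_pi x.
Proof. exact: (esym (hecke_scaleE c x)). Qed.

Lemma hecke_pi_rel x y : hecke_rel (x - y) -> hecke_pi x = hecke_pi y.
Proof. by move=> h; apply/hpi_eq/asboolP. Qed.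

Lemma hecke_pi_surj (z : H) : exists x, z = hecke_pi x.
Proof. exact: hpi_surj. Qed.

Lemma hecke_pi_repr x : hecke_rel (repr (hecke_pi x : {quot hecke_idealz K N}) - x).
Proof. by apply/asboolP/hpi_eq; rewrite reprK. Qed.

Lemma hecke_piN x : hecke_pi (- x) = - hecke_pi x.
Proof.
have pi0 : hecke_pi 0 = 0.
  by apply: etrans (congr1 _ (esym (subrr 0))) _; rewrite hecke_piB subrr.
by rewrite -sub0r hecke_piB pi0 sub0r.
Qed.

Definition T (i : 'I_N.-1) : F := << fmu i >>.

Definition hecke_gen (i : nat) : H :=
  oapp (fun j : 'I_N.-1 => - hecke_pi (T j)) 1 (insub i).

Lemma hecke_gen_relations : hecke_relations *%R N.-1 hecke_gen.
Proof.
apply: hecke_relations_opp => [i|i j ij|i j ij].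
- apply: etrans (esym (hecke_piM _ _)) _; apply: etrans _ (hecke_piN _).
  by apply: hecke_pi_rel; rewrite opprK; apply: hecke_rel_quad.
- apply: etrans (congr1 ( *%R^~ _) (esym (hecke_piM _ _))) _.
  apply: etrans (esym (hecke_piM _ _)) _; apply/esym.
  apply: etrans (congr1 ( *%R^~ _) (esym (hecke_piM _ _))) _.
  apply: etrans (esym (hecke_piM _ _)) _; apply/esym/hecke_pi_rel.
  exact: hecke_rel_braid.
- apply: etrans (esym (hecke_piM _ _)) _; apply: etrans _ (hecke_piM _ _).
  by apply: hecke_pi_rel; apply: hecke_rel_comm; rewrite ij.
Qed.

Definition hecke_of_tensor : {linear tensor -> H} :=
  tensor_map N_gt0 hecke_gen.

Lemma hecke_of_tensorZ c t : hecke_of_tensor (c *: t) = c *: hecke_of_tensor t.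
Proof. exact: linearZ. Qed.

Definition H0_basis (o : corbit) : H0 V := exist _ << val o >> (complete_H0 (@corbitP _ _ o)).

Definition letters (m : {fmonom 'I_N.-1}) : seq nat := [seq val i | i <- m : seq _].

Definition orbit_tensor (o : corbit) : tensor := tens (H0_basis o) 1.

(** A word [m] in the generators [T_i], placed between [a] and [b] in the monoid
    of orbits. The sign turns each [T_i] into [- T_i]; the factors [a] and [b]
    allow induction on the two-sided ideal of relations. *)
Definition word_tensor (a b : corbit) (m : {fmonom 'I_N.-1}) : tensor :=
  (-1) ^+ size m *: orbit_tensor (corbit_mul (corbit_mul a (gen_prod V (letters m))) b).

Lemma lettersM m m' : letters (mmul m m') = letters m ++ letters m'.
Proof. by rewrite /letters fmM map_cat. Qed.

Lemma letters_lt m i : i \in letters m -> (i < N.-1)%N.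
Proof. by case/mapP => j _ ->; apply: ltn_ord. Qed.

Lemma gen_prod_cat w w' :
  gen_prod V (w ++ w') = corbit_mul (gen_prod V w) (gen_prod V w').
Proof. by rewrite /gen_prod big_cat. Qed.

Lemma word_tensorMl a b m m' : word_tensor a b (mmul m m') =
  (-1) ^+ size m *: word_tensor (corbit_mul a (gen_prod V (letters m))) b m'.
Proof.
rewrite /word_tensor lettersM gen_prod_cat corbit_mulA scalerA -exprD.
by rewrite fmM size_cat.
Qed.

Lemma word_tensorMr a b m m' : word_tensor a b (mmul m m') =
  (-1) ^+ size m' *: word_tensor a (corbit_mul (gen_prod V (letters m')) b) m.
Proof.
rewrite /word_tensor lettersM gen_prod_cat !corbit_mulA scalerA -exprD.
by rewrite fmM size_cat addnC.
Qed.

Lemma word_tensor_equiv a b (m m' : {fmonom 'I_N.-1}) : size m = size m' ->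
  hecke_equiv N.-1 (letters m) (letters m') -> word_tensor a b m = word_tensor a b m'.
Proof.
move=> sm /(hecke_equiv_big (@gen_relations k V)); rewrite -!/(gen_prod _ _).
by rewrite /word_tensor sm => ->.
Qed.

Lemma free_lift_word_tensor_rel x : hecke_rel x ->
  forall a b, free_lift (word_tensor a b) x = 0.
Proof.
elim=> {x} [i|i j ij|i j ij||x y _ IHx _ IHy|x y _ IHy|x y _ IHx] a b.
- rewrite malg_mulU free_liftD !free_liftU1.
  have -> : word_tensor a b (mmul (fmu i) (fmu i)) = - word_tensor a b (fmu i).
    rewrite /word_tensor fmM fmU /= expr1 scaleN1r opprK expr2 mulrNN mulr1 scale1r.
    congr (orbit_tensor (corbit_mul (corbit_mul a _) b)).
    rewrite /letters fmM fmU /=; apply: (hecke_equiv_big (@gen_relations k V)).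
    exact: hecke_equiv_idem.
  by rewrite addNr.
- rewrite !malg_mulU free_liftB !free_liftU1; apply/eqP; rewrite subr_eq0; apply/eqP.
  apply: word_tensor_equiv; first by rewrite !fmM !size_cat !fmU.
  rewrite /letters !fmM !fmU /= ij; apply: hecke_equiv_braid.
  by rewrite -ij.
- rewrite !malg_mulU free_liftB !free_liftU1; apply/eqP; rewrite subr_eq0; apply/eqP.
  apply: word_tensor_equiv; first by rewrite !fmM !size_cat !fmU.
  rewrite /letters !fmM !fmU /=; case/orP: ij => ij; last apply: hecke_equiv_sym.
    exact: hecke_equiv_comm.
  exact: hecke_equiv_comm.
- exact: raddf0.
- by rewrite free_liftB IHx IHy subr0.
- rewrite free_liftMl big1 // => m _.
  by rewrite (free_lift_scale _ (word_tensorMl a b m)) IHy !scaler0.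
- rewrite free_liftMr big1 // => m' _.
  by rewrite (free_lift_scale _ (fun m => word_tensorMr a b m m')) IHx !scaler0.
Qed.

Let one := corbit_one V.

Definition tensor_of_hecke (z : H) : tensor :=
  free_lift (word_tensor one one) (repr (z : {quot hecke_idealz K N})).

Lemma tensor_of_hecke_pi x : tensor_of_hecke (hecke_pi x) = free_lift (word_tensor one one) x.
Proof.
apply/eqP; rewrite -subr_eq0 -free_liftB; apply/eqP.
exact: free_lift_word_tensor_rel (hecke_pi_repr x) one one.
Qed.

Lemma hecke_pi_prod (s : seq 'I_N.-1) :
  \prod_(i <- s) hecke_pi (T i) = hecke_pi << FMonom s >>.
Proof.
elim: s => [|i s IHs].
  by rewrite big_nil; congr (hecke_pi << _ >>); apply: val_inj; rewrite /= fm1.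
rewrite big_cons; apply: etrans (congr1 (GRing.mul _) IHs) _.
apply: etrans (esym (hecke_piM _ _)) _; rewrite /T malg_mulU.
by congr (hecke_pi << _ >>); apply: val_inj; rewrite /= fmM fmU.
Qed.

Lemma hecke_of_word_tensor m : hecke_of_tensor (word_tensor one one m) = hecke_pi << m >>.
Proof.
have eM := @tensor_mapE K k V N_gt0 H hecke_gen.
rewrite /word_tensor corbit_mulr1 corbit_mul1 hecke_of_tensorZ.
have -> : hecke_of_tensor (orbit_tensor (gen_prod V (letters m))) =
    \prod_(i <- m : seq _) (- hecke_pi (T i)).
  apply: etrans (eM _ _) _; rewrite scale1r /H0_map /= linextU.
  apply: etrans (orbit_map_basisE _ _ (gen_prod V (letters m))) _.
  apply: etrans (orbit_map_gen_prod N_gt0 hecke_gen_relations (@letters_lt m)) _.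
  by rewrite /letters big_map; apply: eq_bigr => i _; rewrite /hecke_gen valK.
by rewrite scale_prod_opp hecke_pi_prod fmK.
Qed.

Lemma tensor_of_heckeK z : hecke_of_tensor (tensor_of_hecke z) = z.
Proof.
have [x ->] := hecke_pi_surj z; rewrite tensor_of_hecke_pi.
rewrite [in RHS](monalgE x) /free_lift linear_sum.
have pi_sum (I : Type) (s : seq I) (f : I -> F) :
    hecke_pi (\sum_(i <- s) f i) = \sum_(i <- s) hecke_pi (f i).
  exact: (raddf_sum (\pi_({quot hecke_idealz K N}))).
rewrite pi_sum; apply: eq_bigr => m _; rewrite malgU_scale hecke_piZ -hecke_of_word_tensor.
exact: hecke_of_tensorZ.
Qed.

Lemma tensor_of_hecke_word m :
  tensor_of_hecke (hecke_pi << m >>) = (-1) ^+ size m *: orbit_tensor (gen_prod V (letters m)).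
Proof. by rewrite tensor_of_hecke_pi free_liftU1 /word_tensor corbit_mulr1 corbit_mul1. Qed.

Lemma tensor_of_heckeB z z' :
  tensor_of_hecke (z - z') = tensor_of_hecke z - tensor_of_hecke z'.
Proof.
have [[x ->] [x' ->]] := (hecke_pi_surj z, hecke_pi_surj z').
by rewrite -hecke_piB !tensor_of_hecke_pi free_liftB.
Qed.

Lemma tensor_of_heckeZ c z : tensor_of_hecke (c *: z) = c *: tensor_of_hecke z.
Proof.
have [x ->] := hecke_pi_surj z.
by rewrite -hecke_piZ !tensor_of_hecke_pi free_liftZ.
Qed.

Lemma H0_ind (P : H0 V -> Prop) :
    P 0 -> (forall o, P (H0_basis o)) -> (forall a b, P a -> P b -> P (a - b)) ->
  forall a, P a.
Proof.
move=> P0 Pb PB a.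
have PN x : P x -> P (- x) by move=> Px; rewrite -sub0r; apply: PB.
have PD x y : P x -> P y -> P (x + y).
  by move=> Px Py; rewrite -[y]opprK; apply: PB => //; apply: PN.
have PZ x (c : int) : P x -> P (x *~ c).
  move=> Px; have Pn l : P (x *+ l) by elim: l => // l IHl; rewrite mulrS; apply: PD.
  by case: c => l; [exact: Pn | rewrite NegzE mulrNz; apply/PN/Pn].
have aE : val a = linext (fun o => << o >>) (val a).
  elim/malg_int_ind: (val a) => [|o|x y IHx IHy]; rewrite ?raddf0 ?linextU //.
  by rewrite linextB -IHx -IHy.
suff sumP (s : seq (Defs.orbit V)) (c : Defs.orbit V -> int) :
    (forall o, o \in s -> complete_pairs o) ->
    exists2 b : H0 V, P b & val b = \sum_(o <- s) << o >> *~ c o.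
  have [|b Pb' bE] := sumP (msupp (val a)) (fun o => monalg.mcoeff o (val a)).
    by have /H0P := valP a.
  by rewrite (_ : a = b) //; apply/val_inj/(etrans aE (esym bE)).
elim: s => [|o s IHs] h; first by exists 0 => //; rewrite big_nil.
have [|b Pb' bE] := IHs; first by move=> o' o's; apply: h; rewrite inE o's orbT.
have [o' oE] := corbit_of (h o (mem_head _ _)).
exists (H0_basis o' *~ c o + b); first by apply: PD => //; apply: PZ.
by rewrite big_cons -bE oE raddfD raddfMz.
Qed.

Lemma letters_ex (w : seq nat) : (forall i, i \in w -> (i < N.-1)%N) ->
  exists m, letters m = w.
Proof.
elim: w => [|i w IHw] wN; first by exists (FMonom [::]).
have [|m mE] := IHw; first by move=> j jw; apply: wN; rewrite inE jw orbT.
have iN := wN i (mem_head _ _).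
by exists (FMonom (Ordinal iN :: m)); rewrite /letters /= -mE.
Qed.

Lemma tensBl (a b : H0 V) (c : K) : tens (a - b) c = tens a c - tens b c.
Proof.
by apply/eqP; rewrite eq_sym subr_eq; apply/eqP; rewrite -tensDl subrK.
Qed.

Lemma tensor_of_hecke_surj (t : tensor) : exists z, tensor_of_hecke z = t.
Proof.
have z0 : tensor_of_hecke 0 = 0 by rewrite -[0 in LHS](subrr 0) tensor_of_heckeB subrr.
elim/tensor_ind: t => [|a c|t t' [z <-] [z' <-]].
- by exists 0.
- elim/H0_ind: a => [|o|a b [z az] [z' bz]].
  + by exists 0; rewrite z0 -[X in tens X](subrr 0) tensBl subrr.
  + have [w wN <-] := gen_prod_surj o N_gt0; have [m <-] := letters_ex wN.
    exists (c *: ((-1) ^+ size m *: hecke_pi << m >>)).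
    rewrite !tensor_of_heckeZ tensor_of_hecke_word !scalerA -mulrA -exprMn mulrNN mulr1.
    by rewrite expr1n mulr1 tensZ mulr1.
  + by exists (z - z'); rewrite tensor_of_heckeB az bz tensBl.
- by exists (z - z'); rewrite tensor_of_heckeB.
Qed.

Lemma hecke_of_tensor_bij : bijective hecke_of_tensor.
Proof.
exists tensor_of_hecke; last exact: tensor_of_heckeK.
by move=> t; have [z <-] := tensor_of_hecke_surj t; rewrite tensor_of_heckeK.
Qed.

End Isomorphism.

Theorem theorem10p5 (n : nat) (n_ge1 : (1 <= n)%N)
    (k : closedFieldType) (V : vectType k) (dimV : \dim {: V} = n)
    (R : realType) :
  exists phi : {linear tensor (H0 V) R[i] -> hecke0 R[i] n},
    [/\ bijective phi,
        phi (tens (H0_one V) 1) = 1 &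
        forall x y, phi (tensor_mul (@H0_mul k V) x y) = phi x * phi y].
Proof.
move: n_ge1; rewrite -dimV => N_gt0.
exists (hecke_of_tensor R[i] N_gt0); split.
- exact: hecke_of_tensor_bij.
- exact: (tensor_map1 N_gt0 (hecke_gen_relations R[i] V)).
- exact: (tensor_mapM N_gt0 (hecke_gen_relations R[i] V)).
Qed.
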